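(* Let $k\geq 2$ and let $\mathcal{W}_1$ and $\mathcal{W}_2$ be $k$-webs of degree $d$ on the complex projective plane $\mathbb{P}^2$. If their polar families coincide, $\mathcal{R}(\mathcal{W}_1)=\mathcal{R}(\mathcal{W}_2)$, then $\mathcal{W}_1=\mathcal{W}_2$.
   Context: Webs. A $k$-web $\mathcal{W}$ of degree $d$ on $\mathbb{P}^2=\mathbb{P}^2_{\mathbb{C}}$ is given, up to a nonzero constant factor, by a section $\omega\in H^0(\mathbb{P}^2,\mathrm{Sym}^k\Omega^1_{\mathbb{P}^2}\otimes\mathcal{O}_{\mathbb{P}^2}(d+2k))$ whose zero set $\mathrm{Sing}(\mathcal{W})$ has codimension at least two and whose germ at a generic point $x$ is, as a homogeneous polynomial of degree $k$ in $\mathcal{O}_x[dx_1,dx_2]$, square-free and a product of $k$ germs of (integrable) $1$-forms. A point $x\notin \mathrm{Sing}(\mathcal{W})$ is smooth for $\mathcal{W}$ if the germ of $\omega$ at $x$ has these last two properties; the $k$ distinct lines through $x$ tangent to the factors are the tangent lines of $\mathcal{W}$ at $x$. Polar curves. Let $M=\{(x,\ell): x\in\ell\}\subset\mathbb{P}^2\times\check{\mathbb{P}}^2$ with projections $\pi:M\to\mathbb{P}^2$, $\check\pi:M\to\check{\mathbb{P}}^2$. Let $S_{\mathcal{W}}\subset M$ be the closure of the set of $(x,\ell)$ with $x$ a smooth point of $\mathcal{W}$ and $\ell$ a tangent line of $\mathcal{W}$ at $x$. For $p\in\mathbb{P}^2$ let $\mathcal{L}_p$ be the family of lines through $p$ (a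 line in $\check{\mathbb{P}}^2$; also the radial foliation with center $p$), and $\mathcal{H}_p=\check\pi^{-1}(\mathcal{L}_p)$. The polar of $\mathcal{W}$ with center $p$ is $P_p^{\mathcal{W}}=\pi(S_{\mathcal{W}}\cap\mathcal{H}_p)$. When it is not all of $\mathbb{P}^2$ it is considered as a plane curve (divisor) of degree $d+k$: the zero divisor of the section of $\mathcal{O}_{\mathbb{P}^2}(d+k)$ obtained by evaluating $\omega$ on $k$ copies of the vector field $v_p\in H^0(\mathbb{P}^2,T\mathbb{P}^2\otimes\mathcal{O}_{\mathbb{P}^2}(-1))$ defining $\mathcal{L}_p$. Polar family. Let $C(r)=\mathbb{P}H^0(\mathbb{P}^2,\mathcal{O}_{\mathbb{P}^2}(r))$ be the projective space of plane curves of degree $r$, and let $\mathcal{P}$ be the (finite, possibly empty) set of centers of radial foliations tangent to $\mathcal{W}$, i.e. of points $p$ with $P_p^{\mathcal{W}}=\mathbb{P}^2$. The polar family of $\mathcal{W}$ is $\mathcal{R}(\mathcal{W})=\overline{\{P_p^{\mathcal{W}}: p\in\mathbb{P}^2\setminus\mathcal{P}\}}\subseteq C(d+k)$. *)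

(* Defs.v *)
From HB Require Import structures.
(* [mpoly] must be imported before [normedtype] and [derive]: in the other order
   its notations are rejected. *)
From mathcomp Require Import all_boot all_order all_algebra.
From mathcomp Require Import mpoly.
From mathcomp Require Import boolp classical_sets reals complex topology.
From mathcomp Require Import normedtype derive.

Set Implicit Arguments.
Unset Strict Implicit.
Unset Printing Implicit Defensive.

Import GRing.Theory Num.Theory.
Import numFieldNormedType.Exports.
Local Open Scope ring_scope.
Local Open Scope classical_set_scope.

(* Declared at [numClosedFieldType] so that the normed-space structures of
   MathComp-Analysis are inferred on it. *)
Definition Cplx (R : realType) : numClosedFieldType := complex R.

Section Webs.
Variable R : realType.
Local Notation C := (Cplx R).

(* A point of P^2, or a line (a point of the dual plane), is represented by a
   nonzero vector of homogeneous coordinates, a plane curve by a nonzero form up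
   to a nonzero constant factor. *)
Definition incident (x l : 'rV[C]_3) : Prop := \sum_(i < 3) l 0 i * x 0 i = 0.

(* Plane curves of degree [r], up to a nonzero constant factor: the points of
   P H^0(P^2, O(r)). *)
Definition is_curve (r : nat) (F : {mpoly C[3]}) : Prop :=
  F != 0 /\ F \is r.-homog.

(* Zariski closure in P H^0(P^2, O(r)), with the coefficients of a form as
   homogeneous coordinates. The index type consists of the monomials of degree
   at most r; on forms of degree r the coordinates of lower degree vanish. *)
Definition curve_coord (r : nat) (F : {mpoly C[3]})
  (j : 'I_#|{: 'X_{1..3 < r.+1}}|) : C := F@_(enum_val j).

Definition curve_closure (r : nat) (S : set {mpoly C[3]}) : set {mpoly C[3]} :=
  [set F | is_curve r F /\
    forall (e : nat) (Q : {mpoly C[#|{: 'X_{1..3 < r.+1}}|]}),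
      Q \is e.-homog ->
      (forall G, S G -> Q.@[curve_coord (r := r) G] = 0) ->
      Q.@[curve_coord (r := r) F] = 0].

(* Polynomials in two groups of three variables, as polynomials in the second
   group with coefficients that are polynomials in the first one. *)
Definition bihomog (m n : nat) (G : {mpoly {mpoly C[3]}[3]}) : Prop :=
  G \is n.-homog /\ forall u, G@_u \is m.-homog.

Definition eval_fst (G : {mpoly {mpoly C[3]}[3]}) (x : 'rV[C]_3) : {mpoly C[3]} :=
  map_mpoly (meval (fun i => x 0 i)) G.

Definition eval_snd (G : {mpoly {mpoly C[3]}[3]}) (v : 'rV[C]_3) : {mpoly C[3]} :=
  G.@[fun i => (v 0 i)%:MP].

(* By the (dual) Euler sequence, H^0(P^2, Sym^k Omega^1 (d + 2k)) is the space
   of polynomials in dX_0, dX_1, dX_2 (the second group of variables),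
   homogeneous of degree k, whose coefficients are forms of degree d + k in
   X_0, X_1, X_2, and whose contraction with the radial vector field
   X_0 d/dX_0 + X_1 d/dX_1 + X_2 d/dX_2 vanishes. *)
Definition sym_form (k d : nat) (w : {mpoly {mpoly C[3]}[3]}) : Prop :=
  bihomog (d + k) k w /\
  \sum_(i < 3) ('X_i : {mpoly C[3]})%:MP * mderiv i w = 0.

(* The affine chart X_i = 1: its inverse, the affine coordinates of x (with
   x_i <> 0), and the restriction of w to it (so dX_i = 0) as a function with
   values in C[dx_1, dx_2]. *)
Definition chart (i : 'I_3) (y : 'rV[C]_2) : 'rV[C]_3 :=
  \row_(j < 3) oapp (fun j' => y 0 j') 1 (unlift i j).

Definition chart_coord (i : 'I_3) (x : 'rV[C]_3) : 'rV[C]_2 :=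
  \row_(j < 2) (x 0 (lift i j) / x 0 i).

Definition chart_form (w : {mpoly {mpoly C[3]}[3]}) (i : 'I_3) (y : 'rV[C]_2) :
    {mpoly C[2]} :=
  eval_fst w (chart i y) \mPo
    [tuple oapp (fun j' : 'I_2 => 'X_j') 0 (unlift i j) | j < 3].

(* Germs at x0 of holomorphic functions ([differentiable] is complex
   differentiability here, the scalars being C), and of elements of
   O_{x0}[dx_1, dx_2]. *)
Definition holomorphic_germ (x0 : 'rV[C]_2) (f : 'rV[C]_2 -> C) : Prop :=
  \forall y \near x0, differentiable f y.

Definition poly_germ (x0 : 'rV[C]_2) (g : 'rV[C]_2 -> {mpoly C[2]}) : Prop :=
  (exists N : nat, \forall y \near x0, (msize (g y) <= N)%N) /\
  forall m, holomorphic_germ x0 (fun y => (g y)@_m).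

Definition square_free_germ (x0 : 'rV[C]_2) (w : 'rV[C]_2 -> {mpoly C[2]}) : Prop :=
  forall b c : 'rV[C]_2 -> {mpoly C[2]},
    poly_germ x0 b -> poly_germ x0 c ->
    (\forall y \near x0, w y = b y ^+ 2 * c y) ->
    exists2 u, poly_germ x0 u & \forall y \near x0, b y * u y = 1.

Definition linear_form (a : 'rV[C]_2) : {mpoly C[2]} := \sum_(i < 2) a 0 i *: 'X_i.

(* [w] is near x0 the product of the k 1-forms with coefficients [a j];
   integrability is automatic in dimension two. *)
Definition factorization (k : nat) (x0 : 'rV[C]_2) (w : 'rV[C]_2 -> {mpoly C[2]})
    (a : 'I_k -> 'rV[C]_2 -> 'rV[C]_2) : Prop :=
  (forall j i, holomorphic_germ x0 (fun y => a j y 0 i)) /\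
  (\forall y \near x0, w y = \prod_(j < k) linear_form (a j y)).

Definition singular (w : {mpoly {mpoly C[3]}[3]}) (x : 'rV[C]_3) : Prop :=
  eval_fst w x = 0.

Definition smooth_point (k : nat) (w : {mpoly {mpoly C[3]}[3]}) (x : 'rV[C]_3) : Prop :=
  [/\ x != 0, ~ singular w x &
    exists i : 'I_3, [/\ x 0 i != 0,
      square_free_germ (chart_coord i x) (chart_form w i) &
      exists a : 'I_k -> 'rV[C]_2 -> 'rV[C]_2,
        factorization (chart_coord i x) (chart_form w i) a]].

(* In the chart, the line l is the line through x directed by the kernel of
   one of the factors at x. *)
Definition tangent_line (k : nat) (w : {mpoly {mpoly C[3]}[3]}) (x l : 'rV[C]_3) : Prop :=
  l != 0 /\
  exists (i : 'I_3) (a : 'I_k -> 'rV[C]_2 -> 'rV[C]_2) (j : 'I_k),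
    [/\ x 0 i != 0,
      factorization (chart_coord i x) (chart_form w i) a &
      forall y : 'rV[C]_2, incident (chart i y) l <->
        \sum_(m < 2) a j (chart_coord i x) 0 m * (y 0 m - chart_coord i x 0 m) = 0].

(* The zero set has codimension at least two when it contains no curve;
   "generic" means outside some curve. *)
Record web (k d : nat) : Type := Web {
  web_form : {mpoly {mpoly C[3]}[3]};
  web_sym : sym_form k d web_form;
  web_codim : forall (e : nat) (G : {mpoly C[3]}), (0 < e)%N -> is_curve e G ->
    exists x : 'rV[C]_3,
      [/\ x != 0, G.@[fun i => x 0 i] = 0 & ~ singular web_form x];
  web_generic : exists (e : nat) (D : {mpoly C[3]}), is_curve e D /\
    forall x : 'rV[C]_3, x != 0 -> D.@[fun i => x 0 i] != 0 ->
      smooth_point k web_form x }.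

Definition same_web (k d : nat) (W1 W2 : web k d) : Prop :=
  exists2 c : C, c != 0 & web_form W1 = c%:MP *: web_form W2.

(* The surface S_W: Zariski closure in P^2 x dual P^2, whose closed subsets are
   the zero sets of families of bihomogeneous polynomials. *)
Definition web_surface (k d : nat) (W : web k d) (x l : 'rV[C]_3) : Prop :=
  [/\ x != 0, l != 0 &
    forall (m n : nat) (G : {mpoly {mpoly C[3]}[3]}), bihomog m n G ->
      (forall x' l', smooth_point k (web_form W) x' ->
        tangent_line k (web_form W) x' l' ->
        (eval_fst G x').@[fun i => l' 0 i] = 0) ->
      (eval_fst G x).@[fun i => l 0 i] = 0].

Definition polar_set (k d : nat) (W : web k d) (p : 'rV[C]_3) : set 'rV[C]_3 :=
  [set x | exists2 l, web_surface W x l & incident p l].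

Definition radial_center (k d : nat) (W : web k d) (p : 'rV[C]_3) : Prop :=
  forall x : 'rV[C]_3, x != 0 -> polar_set W p x.

(* Under H^0(P^2, TP^2(-1)) = C^3 the field v_p is the constant field p on
   C^3, so evaluating w on k copies of it substitutes p_i for dX_i. *)
Definition polar (k d : nat) (W : web k d) (p : 'rV[C]_3) : {mpoly C[3]} :=
  eval_snd (web_form W) p.

Definition polar_family (k d : nat) (W : web k d) : set {mpoly C[3]} :=
  curve_closure (d + k)
    [set F | exists p : 'rV[C]_3, [/\ p != 0, ~ radial_center W p & F = polar W p]].

End Webs.

(* Main.v *)
(** Write a web as a polynomial [w(x, v)], homogeneous of degree [k] in [v] and
    invariant under [v -> v + t x]; its polar with center [p] is [w(., p)].
    Let [q] be a point which is generic over a countable ring containing the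
    coefficients of both webs. The families [w1(., p)] and [w2(., q)] satisfy the
    same polynomial relations, so that the isomorphism of the rings generated by
    their coefficients extends, C being algebraically closed and uncountable, and
    gives a generic point [p] with [w1(., p) = w2(., q)].

    As [k >= 2], the curve [w2(., q)] is singular at [q], so both [w1(x, p)] and
    its derivatives in [x] vanish at [x = q]. Differentiating [w1(q, p) = 0] while
    [p] moves in an arbitrary direction ([p] is generic, and derivations
    extend to algebraic elements) shows that the derivatives of [w1(q, .)] vanish
    at [p] too. If [p] and [q] were distinct, the line through them would be a
    double factor of [w1(q, .)]; at a generic [q] such a factor spreads out to a
    square factor of the germ of [w1], which is square-free. Hence [p = q] in the
    projective plane, [w1(x, q)] and [w2(x, q)] are proportional for every [q],
    and the invariance in [v] shows that the factor does not depend on [q]. *)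

From HB Require Import structures.
Require Import Defs.
From mathcomp Require Import all_boot all_order all_algebra.
From mathcomp Require Import mpoly.
From mathcomp Require Import boolp classical_sets functions cardinality reals ereal complex.
From mathcomp Require Import topology normedtype derive.
From mathcomp Require Import measure lebesgue_measure.
From mathcomp Require Import ring zify.

Set Implicit Arguments.
Unset Strict Implicit.
Unset Printing Implicit Defensive.

Import Order.TTheory GRing.Theory Num.Theory.
Import numFieldNormedType.Exports.
Local Open Scope ring_scope.
Local Open Scope classical_set_scope.

(** * Algebraic extensions of the image of a ring in C *)

Section MinimalPolynomial.
Variables (A : comNzRingType) (C : numClosedFieldType) (f : {rmorphism A -> C}).
Variable a : C.

(** This is the minimal polynomial of [a] over the fraction field of [f(A)], with denominators
    cleared. As [f] may have a kernel, degrees are compared after applying [f], and the leading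
    coefficient has to survive it. *)
Definition is_minpoly (m : {poly A}) : Prop :=
  [/\ f (lead_coef m) != 0, root (map_poly f m) a &
    forall P : {poly A}, (size (map_poly f P) < size m)%N ->
      root (map_poly f P) a -> map_poly f P = 0].

Lemma minpoly_exists (P : {poly A}) :
  map_poly f P != 0 -> root (map_poly f P) a -> exists m, is_minpoly m.
Proof.
have [n] := ubnP (size (map_poly f P)); elim: n P => // n IHn P szP nzP rP.
have [[Q [nzQ rQ ltQ]]|noQ] := pselect (exists Q : {poly A},
    [/\ map_poly f Q != 0, root (map_poly f Q) a &
        (size (map_poly f Q) < size (map_poly f P))%N]).
  by apply: (IHn Q) => //; rewrite (leq_trans ltQ).
(* The coefficients of [P] beyond the size of its image are killed by [f]; cutting them off keeps
   the image and makes the leading coefficient survive. *)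
pose s := size (map_poly f P); pose m := \poly_(i < s) P`_i.
have s_gt0 : (0 < s)%N by rewrite size_poly_gt0.
have fm : map_poly f m = map_poly f P.
  apply/polyP=> i; rewrite !coef_map coef_poly; case: ltnP => // le_s.
  by rewrite -coef_map nth_default // raddf0.
have lcm : f m`_s.-1 != 0.
  by rewrite coef_poly prednK // leqnn -coef_map -[_`_ _]/(lead_coef _) lead_coef_eq0.
have sm : size m = s.
  apply/eqP; rewrite eqn_leq size_poly /= -[s]prednK // ltnNge.
  by apply: contra lcm => le_s; rewrite nth_default // raddf0.
exists m; split=> [|| Q ltQ rQ]; rewrite ?fm //.
  by rewrite lead_coefE sm.
apply/eqP/negP=> /negP nzQ; case: noQ; exists Q; split=> //.
by rewrite -/s -sm.
Qed.

(** Pseudo-division by [m]: [c] is a power of the leading coefficient, and the remainder vanishes at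
    [a] while being shorter than [m], so minimality kills its image. *)
Lemma minpoly_div (m P : {poly A}) : is_minpoly m -> root (map_poly f P) a ->
  exists c n r, [/\ f c != 0, c *: P = n * m + r & map_poly f r = 0].
Proof.
case=> lcm rm minm rP.
have nzm : m != 0.
  by apply: contraNneq lcm => ->; rewrite lead_coef0 raddf0.
case: (Pdiv.ComRing.redivpP P m) => k n r e /(_ nzm) ltr.
exists (lead_coef m ^+ k), n, r; split=> //; first by rewrite rmorphXn expf_neq0.
apply: minm; first exact: leq_ltn_trans (size_poly _ _) ltr.
have := congr1 (fun p => (map_poly f p).[a]) e.
rewrite /= map_polyZ rmorphD rmorphM /= !hornerE (rootP rP) (rootP rm).
by rewrite !mulr0 add0r => /esym/eqP.
Qed.

Lemma size_map_minpoly m : is_minpoly m -> size (map_poly f m) = size m.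
Proof. by case=> lcm _ _; rewrite size_poly_eq. Qed.

Lemma size_minpoly m : is_minpoly m -> (1 < size m)%N.
Proof.
move=> mm; case: (mm) => lcm rm _; rewrite -(size_map_minpoly mm).
apply: root_size_gt1 rm; apply: contraNneq lcm => m0.
by rewrite lead_coefE -coef_map m0 coef0.
Qed.

(** Separability in characteristic zero: the derivative is shorter than [m] but its top coefficient
    does not vanish, so minimality forbids the root [a]. *)
Lemma minpoly_deriv m : is_minpoly m -> (deriv (map_poly f m)).[a] != 0.
Proof.
move=> mm; apply/negP; rewrite deriv_map => rm'.
have sm := size_minpoly mm; case: (mm) => lcm _ minm.
have nz_m : m != 0 by rewrite -size_poly_gt0 ltnW.
have /(_ _ rm') := minm (deriv m).
rewrite (leq_ltn_trans (size_poly _ _)) ?lt_size_deriv // => /(_ isT) m'0.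
have := congr1 (fun p : {poly C} => p`_(size m).-2) m'0.
rewrite /= coef0 coef_map coef_deriv raddfMn /=.
have -> : ((size m).-2.+1 = (size m).-1)%N by case: (size m) sm => [|[]].
move/eqP; rewrite mulrn_eq0 -lead_coefE (negbTE lcm) orbF.
by case: (size m) sm => [|[]].
Qed.

End MinimalPolynomial.

Section Extension.
Variables (A : comNzRingType) (C : numClosedFieldType).
Implicit Types f g : {rmorphism A -> C}.

Definition same_kernel (B : comNzRingType) (f g : B -> C) : Prop :=
  forall x, f x = 0 <-> g x = 0.

Lemma same_kernel_map f g (P : {poly A}) : same_kernel f g ->
  map_poly f P = 0 <-> map_poly g P = 0.
Proof.
move=> fg; split=> /polyP e0; apply/polyP=> i; move: (e0 i);
  by rewrite !coef_map coef0 => /fg.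
Qed.

(** Equal kernels mean that [f(A)] and [g(A)] are isomorphic; sending [a] to a conjugate root [b]
    extends the isomorphism to the rings that these elements generate. *)
Lemma minpoly_same_kernel f g (a b : C) (m : {poly A}) :
  same_kernel f g -> is_minpoly f a m -> root (map_poly g m) b ->
  forall P : {poly A}, root (map_poly f P) a <-> root (map_poly g P) b.
Proof.
move=> fg mm rmb.
have fwd (P : {poly A}) : root (map_poly f P) a -> root (map_poly g P) b.
  move=> rP; have [c [n [r [nzc e r0]]]] := minpoly_div mm rP.
  have {}r0 : map_poly g r = 0 by apply/(same_kernel_map _ fg).
  have nzgc : g c != 0 by apply: contra_neq nzc => /fg.
  have := congr1 (fun p => (map_poly g p).[b]) e.
  rewrite /= map_polyZ rmorphD rmorphM /= !hornerE r0 (rootP rmb) horner0.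
  by rewrite mulr0 addr0 => /eqP; rewrite mulf_eq0 (negbTE nzgc).
move=> P; split=> [|rP]; first exact: fwd.
have [lcm rm minm] := mm.
have nzgm : map_poly g m != 0.
  apply/eqP=> /(same_kernel_map _ fg)/(congr1 (size \o polyseq)) /=.
  by rewrite (size_map_minpoly mm) size_poly0; have := size_minpoly mm; case: size.
have [m' mm'] := minpoly_exists nzgm rmb.
have [lcm' rm' minm'] := mm'.
(* If the minimal polynomial [m'] of [b] were shorter than [m], it would divide [m] under [f] too,
   and [a] would be a root of one of two factors, both shorter than [m]. *)
have [lt_m'm|le_mm'] := ltnP (size m') (size m).
  have [c [n [r [nzc e r0]]]] := minpoly_div mm' rmb.
  have {}r0 : map_poly f r = 0 by apply/(same_kernel_map _ fg).
  have nzfc : f c != 0 by apply: contra_neq nzc => /fg.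
  have nzlf : f (lead_coef m') != 0 by apply: contra_neq lcm' => /fg.
  have sm' : size (map_poly f m') = size m' by rewrite size_poly_eq.
  have nzfm' : map_poly f m' != 0.
    by rewrite -size_poly_gt0 sm' ltnW // (size_minpoly mm').
  have e' : f c *: map_poly f m = map_poly f n * map_poly f m'.
    by rewrite -map_polyZ e rmorphD rmorphM /= r0 addr0.
  have nzfm : map_poly f m != 0.
    by rewrite -size_poly_gt0 (size_map_minpoly mm) ltnW // (size_minpoly mm).
  have nzn : map_poly f n != 0.
    apply: contraNneq nzfm => n0; move: e'; rewrite n0 mul0r => /eqP.
    by rewrite scaler_eq0 (negbTE nzfc).
  have := rm; rewrite -(rootZ _ _ nzfc) e' rootM => /orP[rn|rm'f].
    have := minm n; rewrite rn => /(_ _ isT) n0; case/eqP: (nzn); apply: n0.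
    have := congr1 (size \o polyseq) e'; rewrite /= size_scale // size_mul //.
    rewrite (size_map_minpoly mm) sm' => ->.
    have := size_minpoly mm'; case: (size m') => [|[|s]] // _.
    by rewrite !addnS /= ltnS leq_addr.
  have := minm m'; rewrite sm' rm'f => /(_ lt_m'm isT) m'0.
  by rewrite m'0 eqxx in nzfm'.
have mm2 : is_minpoly g b m.
  split=> [|//|Q ltQ]; first by apply: contra_neq lcm => /fg.
  by apply: minm'; exact: leq_trans le_mm'.
have [c [n [r [nzc e r0]]]] := minpoly_div mm2 rP.
have {}r0 : map_poly f r = 0 by apply/(same_kernel_map _ fg).
have nzfc : f c != 0 by apply: contra_neq nzc => /fg.
rewrite -(rootZ _ _ nzfc) -map_polyZ e rmorphD rmorphM /= r0 addr0.
by rewrite rootM rm orbT.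
Qed.

Definition transcendental f (a : C) : Prop :=
  forall P : {poly A}, root (map_poly f P) a -> map_poly f P = 0.

(** A transcendental [a] is sent to a transcendental element, an algebraic one to a root of the
    transported minimal polynomial, which exists as [C] is algebraically closed. *)
Lemma same_kernel_ext f g (a : C) :
  same_kernel f g -> (exists b, transcendental g b) ->
  exists b, forall P : {poly A}, root (map_poly f P) a <-> root (map_poly g P) b.
Proof.
move=> fg [t tt].
have [tr|] := pselect (transcendental f a).
  exists t => P; split=> [/tr|/tt] /(same_kernel_map _ fg) ->; exact: root0.
move=> /existsNP[P /not_implyP[rP /eqP nzP]].
have [m mm] := minpoly_exists nzP rP.
have [lcm rm _] := mm; have nzgm : g (lead_coef m) != 0.
  by apply: contra_neq lcm => /fg.
have /closed_rootP[b rb] : size (map_poly g m) != 1%N.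
  by rewrite size_poly_eq // neq_ltn (size_minpoly mm) orbT.
by exists b; exact: minpoly_same_kernel rb.
Qed.

End Extension.

(* [m] is the minimal polynomial of [a], which occurs at least twice in [P]. *)
Lemma double_root_square (A : comNzRingType) (C : numClosedFieldType)
    (f : {rmorphism A -> C}) (a : C) (P : {poly A}) :
  map_poly f P != 0 -> root (map_poly f P) a -> root (deriv (map_poly f P)) a ->
  exists c m n r, [/\ f c != 0, c *: P = n * m ^+ 2 + r, map_poly f r = 0,
    f (lead_coef m) != 0 & (1 < size m)%N].
Proof.
move=> nzP rP rP'; have [m mm] := minpoly_exists nzP rP.
have [c [n [r [nzc e r0]]]] := minpoly_div mm rP.
have rn : root (map_poly f n) a.
  have := congr1 (fun p => (deriv (map_poly f p)).[a]) e.
  rewrite /= map_polyZ rmorphD rmorphM /= r0 addr0 derivZ derivM !hornerE.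
  case: (mm) => _ /rootP -> _; rewrite (rootP rP') !mulr0 add0r => /esym/eqP.
  by rewrite mulf_eq0 (negbTE (minpoly_deriv mm)) orbF.
have [c2 [n2 [r2 [nzc2 e2 r20]]]] := minpoly_div mm rn.
have [lcm _ _] := mm.
exists (c2 * c), m, n2, (r2 * m + c2 *: r); split=> //.
- by rewrite rmorphM mulf_neq0.
- by rewrite -scalerA e scalerDr scalerAl e2 mulrDl expr2 mulrA addrA.
- by rewrite rmorphD rmorphM /= map_polyZ r0 r20 mul0r scaler0 addr0.
exact: size_minpoly mm.
Qed.

(** * Extension of derivations to rings with more generators *)

Section Tangent.
Variable C : numClosedFieldType.

(* [D] is a vector tangent at the point [f] of Spec A to the closure of that
   point: the last clause says that it kills the ideal of this closure. *)
Definition tangent (A : comNzRingType) (f D : A -> C) : Prop :=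
  [/\ forall x y, D (x + y) = D x + D y,
      forall x y, D (x * y) = f x * D y + f y * D x &
      forall x, f x = 0 -> D x = 0].

Lemma tangent_ext (A : comNzRingType) (f : {rmorphism A -> C}) (D : A -> C) a :
  tangent f D ->
  exists2 D' : {poly A} -> C, tangent (fun P => (map_poly f P).[a]) D' &
    forall c, D' c%:P = D c.
Proof.
case=> DD DM Dker; have D0 : D 0 = 0 by apply: Dker; rewrite raddf0.
pose E (P : {poly A}) := (map_poly D P).[a].
have ED P Q : E (P + Q) = E P + E Q.
  rewrite /E -hornerD; congr (_.[_]); apply/polyP=> i.
  by rewrite coefD !coef_map_id0 // coefD DD.
have E0 : E 0 = 0 by rewrite /E map_poly0 horner0.
have EC c : E c%:P = D c.
  rewrite /E (_ : map_poly D c%:P = (D c)%:P) ?hornerC //.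
  by apply/polyP=> i; rewrite coef_map_id0 // !coefC; case: eqP.
have EX P : E (P * 'X) = E P * a.
  rewrite /E -hornerMX; congr (_.[_]); apply/polyP=> i.
  by rewrite coefMX !coef_map_id0 // coefMX; case: eqP.
have ECM c P : E (c%:P * P) = f c * E P + (map_poly f P).[a] * D c.
  rewrite /E [X in _ = _ + X]mulrC -!hornerZ -hornerD; congr (_.[_]).
  apply/polyP=> i; rewrite coefD !coefZ !coef_map_id0 ?raddf0 // coefCM DM.
  by rewrite [D c * _]mulrC.
have EM P Q : E (P * Q) = (map_poly f P).[a] * E Q + (map_poly f Q).[a] * E P.
  elim/poly_ind: P => [|P c IHP].
    by rewrite mul0r E0 raddf0 horner0 mul0r mulr0 addr0.
  rewrite mulrDl ED mulrAC EX IHP ECM ED EX EC rmorphD rmorphM /=.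
  by rewrite map_polyX map_polyC /= hornerD hornerMX hornerC; ring.
(* [E] differentiates the coefficients only; [eta] is the value given to the derivation at the
   variable, still to be chosen so that relations of [a] are killed. *)
pose D' eta P := E P + eta * (deriv (map_poly f P)).[a].
suff [eta Heta] : exists eta, forall P, (map_poly f P).[a] = 0 -> D' eta P = 0.
  exists (D' eta); last by move=> c; rewrite /D' EC map_polyC derivC horner0 mulr0 addr0.
  split=> // P Q; first by rewrite /D' ED rmorphD derivD hornerD; ring.
  by rewrite /D' EM rmorphM derivM hornerD !hornerM; ring.
have [tr|] := pselect (transcendental f a).
  exists 0 => P /eqP /tr P0; rewrite /D' mul0r addr0 /E.
  rewrite (_ : map_poly D P = 0) ?horner0 //; apply/polyP=> i.
  by rewrite coef_map_id0 // coef0; apply: Dker; rewrite -coef_map P0 coef0.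
move=> /existsNP[P /not_implyP[rP /eqP nzP]].
have [m mm] := minpoly_exists nzP rP.
have nzm' := minpoly_deriv mm; have [_ /rootP rm _] := mm.
(* This value is forced by [D' eta m = 0], and separability allows the division. Any other relation
   is a multiple of [m] modulo the kernel, up to a nonzero factor. *)
exists (- E m / (deriv (map_poly f m)).[a]) => Q /eqP rQ.
have [c [n [r [nzc e r0]]]] := minpoly_div mm rQ.
have Er : E r = 0.
  rewrite /E (_ : map_poly D r = 0) ?horner0 //; apply/polyP=> i.
  by rewrite coef_map_id0 // coef0; apply: Dker; rewrite -coef_map r0 coef0.
have e1 : f c * E Q = (map_poly f n).[a] * E m.
  have := congr1 E e; rewrite /= ED EM Er -mul_polyC ECM (rootP rQ) rm.
  by rewrite !mul0r !addr0.
have e2 : f c * (deriv (map_poly f Q)).[a]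
        = (map_poly f n).[a] * (deriv (map_poly f m)).[a].
  have := congr1 (fun p => (deriv (map_poly f p)).[a]) e.
  rewrite /= map_polyZ rmorphD rmorphM /= r0 addr0 derivZ derivM !hornerE rm.
  by rewrite mulr0 add0r.
apply: (mulfI nzc); rewrite mulr0 /D' mulrDr e1 mulrCA e2.
by field.
Qed.

End Tangent.

(** * Several variables, treated one at a time *)

Section MultivariateExtension.

Lemma mpoly_rmorph_ext n (A : comNzRingType) (B : nzRingType)
    (F G : {rmorphism {mpoly A[n]} -> B}) :
  (forall c, F c%:MP = G c%:MP) -> (forall i, F 'X_i = G 'X_i) -> F =1 G.
Proof.
move=> FGC FGX P; rewrite [P]mpolyE !rmorph_sum /=; apply: eq_bigr => m _.
rewrite -mul_mpolyC !rmorphM FGC; congr (_ * _).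
by rewrite mpolyXE_id !rmorph_prod; apply: eq_bigr => i _; rewrite !rmorphXn FGX.
Qed.

Definition horner_at (A B : comNzRingType) (f : {rmorphism A -> B}) (b : B) :=
  horner_morph (fun x => mulrC b (f x)).

HB.instance Definition _ (A B : comNzRingType) (f : {rmorphism A -> B}) (b : B) :=
  GRing.RMorphism.on (horner_at f b).

Variables (n : nat).

(** The variable of index [ord0] moves into the coefficients. Inductions on the number of variables
    thus pass from the ring [A] to [{poly A}]. *)
Definition mcurry (A : comNzRingType) : {mpoly A[n.+1]} -> {mpoly {poly A}[n]} :=
  mmap (@mpolyC n {poly A} \o @polyC A) (fun i => oapp (fun j => 'X_j) 'X%:MP (unlift ord0 i)).

HB.instance Definition _ (A : comNzRingType) := GRing.RMorphism.on (@mcurry A).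

Lemma mcurryC (A : comNzRingType) c : @mcurry A c%:MP = c%:P%:MP.
Proof. exact: mmapC. Qed.

Lemma mcurryX (A : comNzRingType) i :
  @mcurry A 'X_i = oapp (fun j => 'X_j) 'X%:MP (unlift ord0 i).
Proof. by rewrite /mcurry mmapX mmap1U. Qed.

Lemma mmap_mcurry (A B : comNzRingType) (f : {rmorphism A -> B}) (b : 'I_n.+1 -> B) P :
  mmap (horner_at f (b ord0)) (fun i => b (lift ord0 i)) (mcurry P) = mmap f b P.
Proof.
move: P; apply: (mpoly_rmorph_ext
  (F := mmap (horner_at f (b ord0)) (fun i => b (lift ord0 i)) \o @mcurry A)
  (G := mmap f b)) => [c|i] /=.
  by rewrite mcurryC !mmapC /= /horner_at /horner_morph map_polyC hornerC.
rewrite mcurryX [RHS]mmapX mmap1U.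
case: unliftP => [j ->|->] /=; first by rewrite mmapX mmap1U.
by rewrite mmapC /= /horner_at /horner_morph map_polyX hornerX.
Qed.

Lemma mcurry_inj (A : comNzRingType) : injective (@mcurry A).
Proof.
pose h (i : 'I_n.+1) : {mpoly A[n.+1]} := 'X_i.
apply: (can_inj (g := mmap (horner_at (@mpolyC n.+1 A) (h ord0))
  (fun i => h (lift ord0 i)))) => P.
rewrite mmap_mcurry; move: P; apply: (mpoly_rmorph_ext
  (F := mmap (@mpolyC n.+1 A) h) (G := idfun)) => [c|i] /=; first exact: mmapC.
by rewrite mmapX mmap1U.
Qed.

End MultivariateExtension.


(** Any derivation follows a point [a] of affine space, by adjoining its coordinates one after
    another, whether they are algebraic or transcendental. *)
Lemma tangent_mpoly (C : numClosedFieldType) n (A : comNzRingType)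
    (f : {rmorphism A -> C}) (D : A -> C) (a : 'I_n -> C) :
  tangent f D ->
  exists2 D' : {mpoly A[n]} -> C, tangent (mmap f a) D' &
    forall c, D' c%:MP = D c.
Proof.
elim: n A f D a => [|n IHn] A f D a tD.
  exists (fun P => D P@_0%MM); last by move=> c; rewrite mpolyCK.
  have fE (P : {mpoly A[0]}) : mmap f a P = f P@_0%MM.
    by rewrite {1}[P]nvar0_mpolyC mmapC.
  have cM (P Q : {mpoly A[0]}) : (P * Q)@_0%MM = P@_0%MM * Q@_0%MM.
    by rewrite {1}[P]nvar0_mpolyC {1}[Q]nvar0_mpolyC -mpolyCM mpolyCK.
  case: tD => DD DM Dk; split=> [P Q|P Q|P]; first by rewrite mcoeffD DD.
    by rewrite cM DM !fE.
  by rewrite fE => /Dk.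
have [D1 tD1 D1C] := tangent_ext (a ord0) tD.
have [D2 [DD DM Dk] D2C] :=
  IHn {poly A} (horner_at f (a ord0)) D1 (fun i => a (lift ord0 i)) tD1.
exists (D2 \o @mcurry n A); last by move=> c; rewrite /= mcurryC D2C D1C.
split=> [P Q|P Q|P] /=; first by rewrite rmorphD DD.
  by rewrite rmorphM DM !mmap_mcurry.
by rewrite -mmap_mcurry => /Dk.
Qed.

(** * Countability and the existence of generic points *)

Section Countable.

Lemma countable_poly (A : comNzRingType) :
  countable [set: A] -> countable [set: {poly A}].
Proof.
move=> /countable_injP[e inj_e]; apply/countable_injP.
exists (fun P => pickle (map e P)) => P Q _ _ /(pcan_inj pickleK) eq_e.
by apply/val_inj/(inj_map _ eq_e) => x y; apply: inj_e; rewrite inE.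
Qed.

Lemma countable_mpoly n (A : comNzRingType) :
  countable [set: A] -> countable [set: {mpoly A[n]}].
Proof.
move=> /countable_injP[e inj_e]; apply/countable_injP.
pose s (P : {mpoly A[n]}) := [seq (m, e P@_m) | m <- msupp P].
exists (fun P => pickle (s P)) => P Q _ _ /(pcan_inj pickleK) eq_s.
have eq_supp : msupp P = msupp Q.
  have s1 T : unzip1 (s T) = msupp T.
    by rewrite /unzip1 /s; elim: (msupp T) => //= m r ->.
  by rewrite -!s1 eq_s.
apply/mpolyP => m; have [mP|mNP] := boolP (m \in msupp P); last first.
  by rewrite !memN_msupp_eq0 -?eq_supp.
have : (m, e P@_m) \in s Q by rewrite -eq_s; apply/mapP; exists m.
case/mapP=> m' _ [<-] /inj_e; apply; by rewrite inE.
Qed.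

(** Otherwise the real line would be countable and so have Lebesgue measure zero. *)
Lemma uncountable_Cplx (R : realType) : ~ countable [set: Cplx R].
Proof.
move=> /countable_injP[e inj_e].
have cR : countable [set: R].
  apply/countable_injP; exists (fun x : R => e (x%:C)%C) => x y _ _ /inj_e.
  by rewrite !inE => /(_ I I) [].
have := countable_lebesgue_measure0 cR.
have eT : [set: R] = [set` `]-oo, +oo[%R ] by rewrite set_itvE.
by rewrite {1}eT lebesgue_measure_itv.
Qed.

(** There are countably many polynomials with nonzero image, each with finitely many roots; together
    they cannot cover the uncountable field. *)
Lemma transcendental_exists (R : realType) (A : comNzRingType)
    (g : {rmorphism A -> Cplx R}) :
  countable [set: A] -> exists b, transcendental g b.
Proof.
move=> cA; apply: contrapT => notr; apply: (@uncountable_Cplx R).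
pose rts (P : {poly A}) := [set b | map_poly g P != 0 /\ root (map_poly g P) b].
suff : countable (\bigcup_(P in [set: {poly A}]) rts P).
  apply: sub_countable; apply: subset_card_le => b _; apply: contrapT => nb.
  apply: notr; exists b => P rP; apply: contrapT => /eqP nzP.
  by apply: nb; exists P.
apply: bigcup_countable => [|P _]; first exact: countable_poly.
apply: finite_set_countable.
have [r rE] := closed_field_poly_normal (map_poly g P).
apply: (@sub_finite_set _ _ [set` r ]) => // b [nzP].
by rewrite rE rootZ ?lead_coef_eq0 // root_prod_XsubC.
Qed.

Lemma generic_point_exists (R : realType) n (A : comNzRingType)
    (g : {rmorphism A -> Cplx R}) :
  countable [set: A] -> exists b : 'I_n -> Cplx R,
    forall P : {mpoly A[n]}, mmap g b P = 0 -> map_mpoly g P = 0.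
Proof.
elim: n A g => [|n IHn] A g cA.
  exists (fun => 0) => P; rewrite [P]nvar0_mpolyC mmapC => P0.
  by rewrite map_mpolyC P0.
have [b0 tr0] := transcendental_exists g cA.
have [b Hb] := IHn {poly A} (horner_at g b0) (countable_poly cA).
exists (fun i => oapp b b0 (unlift ord0 i)) => P.
rewrite -mmap_mcurry unlift_none /=.
have -> : (fun i => oapp b b0 (unlift ord0 (lift ord0 i))) = b.
  by apply/funext => i; rewrite liftK.
move/Hb => e0; apply: (@mcurry_inj n); rewrite raddf0.
have -> : mcurry (map_mpoly g P) = map_mpoly (map_poly g) (mcurry P).
  move: P {e0}; apply: (mpoly_rmorph_ext (F := @mcurry n _ \o map_mpoly g)
    (G := map_mpoly (map_poly g) \o @mcurry n A)) => [c|i] /=.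
    by rewrite map_mpolyC !mcurryC map_mpolyC /= map_polyC.
  rewrite map_mpolyX !mcurryX; case: unlift => [j|] /=; first by rewrite map_mpolyX.
  by rewrite map_mpolyC; congr (_%:MP); apply/esym/map_polyX.
apply/mpolyP => m; rewrite mcoeff_map_mpoly mcoeff0; apply: tr0; apply/eqP.
have := congr1 (mcoeff m) e0.
by rewrite mcoeff_map_mpoly mcoeff0.
Qed.

End Countable.

(** An isomorphism of countable subrings extends when the coordinates of [a] are adjoined to its
    source. Countability persists at each stage and supplies the transcendental elements. *)
Lemma same_kernel_mpoly (R : realType) n (A : comNzRingType)
    (f g : {rmorphism A -> Cplx R}) (a : 'I_n -> Cplx R) :
  countable [set: A] -> same_kernel f g ->
  exists b, same_kernel (mmap f a) (mmap g b).
Proof.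
elim: n A f g a => [|n IHn] A f g a cA fg.
  by exists a => P; rewrite [P]nvar0_mpolyC !mmapC; apply: fg.
have [b0 Hb0] := same_kernel_ext (a ord0) fg (transcendental_exists g cA).
have [|b Hb] := IHn {poly A} (horner_at f (a ord0)) (horner_at g b0)
  (fun i => a (lift ord0 i)) (countable_poly cA).
  by move=> P; split=> /eqP; have := Hb0 P => -[h1 h2];
    [move/h1/eqP | move/h2/eqP].
exists (fun i => oapp b b0 (unlift ord0 i)) => P.
rewrite -!mmap_mcurry unlift_none /=.
have -> : (fun i => oapp b b0 (unlift ord0 (lift ord0 i))) = b.
  by apply/funext => i; rewrite liftK.
exact: Hb.
Qed.

(** * Derivatives of polynomials in two groups of variables *)

Section PolynomialFunctions.
Variable C : numClosedFieldType.

Lemma poly_eq0_horner (P : {poly C}) : (forall t, P.[t] = 0) -> P = 0.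
Proof.
move=> P0; apply/eqP; apply/negP=> /negP nzP.
have := @max_poly_roots _ P [seq i%:R | i <- iota 0 (size P)] nzP.
rewrite size_map size_iota ltnn => H; suff : false by [].
apply: H; first by apply/allP=> t _; rewrite /root P0.
by rewrite map_inj_uniq ?iota_uniq // => i j /eqP; rewrite eqr_nat => /eqP.
Qed.

Lemma deriv_eq0_const (P : {poly C}) t : deriv P = 0 -> P.[t] = P.[0].
Proof.
move=> P'0; suff -> : P = (P`_0)%:P by rewrite !hornerC.
apply/polyP=> -[|i]; rewrite coefC //=.
have := congr1 (fun Q : {poly C} => Q`_i) P'0.
by rewrite /= coef_deriv coef0 => /eqP; rewrite mulrn_eq0 => /eqP.
Qed.

Lemma mpoly_eq0_meval n (P : {mpoly C[n]}) :
  (forall v : 'I_n -> C, P.@[v] = 0) -> P = 0.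
Proof.
elim: n P => [|n IHn] P P0.
  by have := P0 (fun=> 0); rewrite [P]nvar0_mpolyC mevalC => ->.
apply: (@mcurry_inj n); rewrite raddf0; apply/mpolyP => m; rewrite mcoeff0.
apply: poly_eq0_horner => t.
suff : map_mpoly (horner_at idfun t) (mcurry P) = 0.
  move/(congr1 (mcoeff m)); rewrite mcoeff0.
  rewrite mcoeff_map_mpoly => <-; congr (_.[_]).
  by apply/esym/map_poly_id.
apply: IHn => v; rewrite -(P0 (fun i => oapp v t (unlift ord0 i))).
rewrite -[RHS]mmap_mcurry unlift_none /=.
have -> : (fun i => oapp v t (unlift ord0 (lift ord0 i))) = v.
  by apply/funext => i; rewrite liftK.
move: (mcurry P); apply: (mpoly_rmorph_ext
  (F := meval v \o map_mpoly (horner_at idfun t))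
  (G := mmap (horner_at idfun t) v)) => [c|i] /=.
  by rewrite map_mpolyC mevalC mmapC.
by rewrite map_mpolyX mevalXU mmapX mmap1U.
Qed.

End PolynomialFunctions.

Section ChainRule.

(** The first sum is the effect of [D] on the coefficients. For monomials only the second sum is
    left: that identity holds for the variables and passes to products. *)
Lemma mderivation_chain n (A B : comNzRingType) (F : {rmorphism {mpoly A[n]} -> B})
    (D : {mpoly A[n]} -> B) :
  (forall P Q, D (P + Q) = D P + D Q) ->
  (forall P Q, D (P * Q) = F P * D Q + F Q * D P) ->
  forall P, D P = \sum_(m <- msupp P) D (P@_m)%:MP * F 'X_[m]
                  + \sum_i F (mderiv i P) * D 'X_i.
Proof.
move=> DD DM; pose good P := D P = \sum_i F (mderiv i P) * D 'X_i.
have D0 : D 0 = 0 by apply: (addrI (D 0)); rewrite -DD !addr0.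
have D1 : D 1 = 0.
  by apply: (addrI (D 1)); have := DM 1 1; rewrite !mulr1 rmorph1 mul1r addr0 => <-.
have good1 : good 1.
  rewrite /good D1 big1 // => i _.
  by rewrite -mpolyC1 mderivC raddf0 mul0r.
have goodM P Q : good P -> good Q -> good (P * Q).
  rewrite /good DM => -> ->; rewrite !mulr_sumr -big_split /=.
  by apply: eq_bigr => i _; rewrite mderivM rmorphD !rmorphM /=; ring.
have goodX i : good 'X_i.
  rewrite /good (bigD1 i) //= big1 ?addr0 => [|j ji]; rewrite mderivX mnm1E.
    rewrite eqxx scale1r (_ : (U_(i) - U_(i))%MM = 0%MM) ?mpolyX0 ?rmorph1 ?mul1r //.
    by apply/mnmP=> l; rewrite mnmBE subnn mnm0E.
  by rewrite eq_sym (negbTE ji) scale0r raddf0 mul0r.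
have good_mon m : good 'X_[m].
  rewrite mpolyXE_id; apply: big_ind => // i _.
  by elim: (m i) => [|d IHd]; rewrite ?expr0 // exprS; apply: goodM.
have Dsum (I : Type) (r : seq I) (E : I -> {mpoly A[n]}) :
    D (\sum_(i <- r) E i) = \sum_(i <- r) D (E i).
  by elim: r => [|i r IHr]; rewrite ?big_nil // !big_cons DD IHr.
move=> P; rewrite {1}[P]mpolyE Dsum.
have dP i : F (mderiv i P) = \sum_(m <- msupp P) F (P@_m)%:MP * F (mderiv i 'X_[m]).
  rewrite {1}[P]mpolyE (raddf_sum (mderiv i)) (raddf_sum F). apply: eq_bigr => m _.
  by rewrite /= -mul_mpolyC mderivM mderivC mul0r add0r rmorphM.
under [X in _ + X]eq_bigr => i _ do rewrite dP mulr_suml.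
rewrite exchange_big -big_split /=; apply: eq_bigr => m _.
rewrite -mul_mpolyC DM good_mon addrC; congr (_ + _); last exact: mulrC.
by rewrite mulr_sumr; apply: eq_bigr => i _; rewrite mulrA.
Qed.

Definition mderiv_coef n (A : comNzRingType) (l : 'I_n)
  (W : {mpoly {mpoly A[n]}[n]}) := map_mpoly (mderiv l) W.

Lemma mderivation_chain2 n (A B : comNzRingType)
    (F : {rmorphism {mpoly {mpoly A[n]}[n]} -> B})
    (D : {mpoly {mpoly A[n]}[n]} -> B) :
  (forall P Q, D (P + Q) = D P + D Q) ->
  (forall P Q, D (P * Q) = F P * D Q + F Q * D P) ->
  (forall c, D c%:MP%:MP = 0) ->
  forall W, D W = \sum_l F (mderiv_coef l W) * D ('X_l)%:MP
                  + \sum_i F (mderiv i W) * D 'X_i.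
Proof.
move=> DD DM D0 W; rewrite (mderivation_chain DD DM); congr (_ + _).
have DC c : D c%:MP = \sum_l F (mderiv l c)%:MP * D ('X_l)%:MP.
  have := @mderivation_chain n A B (F \o @mpolyC n _) (fun c => D c%:MP).
  move=> -> /=; first by rewrite big1 ?add0r // => m _; rewrite D0 mul0r.
    by move=> P Q; rewrite mpolyCD DD.
  by move=> P Q; rewrite mpolyCM DM.
under eq_bigr => m _ do rewrite DC mulr_suml.
rewrite exchange_big; apply: eq_bigr => l _ /=.
rewrite /mderiv_coef /map_mpoly /mmap rmorph_sum mulr_suml /=.
apply: eq_bigr => m _; rewrite rmorphM /= mmap1_id; ring.
Qed.

End ChainRule.

Section TwoVariableGroups.
Variables (n : nat) (C : numClosedFieldType).
Implicit Types (W : {mpoly {mpoly C[n]}[n]}) (x v : 'I_n -> C).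

Definition eval2 W x v : C := mmap (meval x) v W.

Lemma eval2_fst W x v : (map_mpoly (meval x) W).@[v] = eval2 W x v.
Proof.
move: W; apply: (mpoly_rmorph_ext (F := meval v \o map_mpoly (meval x))
  (G := mmap (meval x) v)) => [c|i] /=; first by rewrite map_mpolyC mevalC mmapC.
by rewrite map_mpolyX mevalXU mmapX mmap1U.
Qed.

Lemma eval2_snd W x v : (W.@[fun i => (v i)%:MP]).@[x] = eval2 W x v.
Proof.
move: W; apply: (mpoly_rmorph_ext (F := meval x \o meval (fun i => (v i)%:MP))
  (G := mmap (meval x) v)) => [c|i] /=; first by rewrite mevalC mmapC.
by rewrite mevalXU mevalC mmapX mmap1U.
Qed.

Lemma mmap_homog (A B : comNzRingType) (f : {rmorphism A -> B}) k (P : {mpoly A[n]})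
    (c : B) (h : 'I_n -> B) : P \is k.-homog ->
  mmap f (fun i => c * h i) P = c ^+ k * mmap f h P.
Proof.
move=> /dhomogP hP; rewrite /mmap mulr_sumr; apply: eq_big_seq => m /hP <-.
rewrite mulrCA; congr (_ * _); rewrite /mmap1.
under eq_bigr => i _ do rewrite exprMn.
by rewrite big_split /= prodrXr -mdegE.
Qed.

Lemma eval2_homog_snd k W x v c : W \is k.-homog ->
  eval2 W x (fun i => c * v i) = c ^+ k * eval2 W x v.
Proof. exact: mmap_homog. Qed.

Lemma eval2_homog_fst k W x v c : (forall u, W@_u \is k.-homog) ->
  eval2 W (fun i => c * x i) v = c ^+ k * eval2 W x v.
Proof.
move=> hW; rewrite /eval2 /mmap mulr_sumr; apply: eq_bigr => m _.
by rewrite mulrA; congr (_ * _); exact: mmap_homog.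
Qed.

Lemma mderiv_homog (A : comNzRingType) k i (P : {mpoly A[n]}) : P \is k.+1.-homog ->
  mderiv i P \is k.-homog.
Proof.
move=> /dhomogP hP; apply/dhomogP => m; rewrite mcoeff_msupp mcoeff_mderiv => nz.
have /hP : (m + U_(i))%MM \in msupp P.
  by rewrite mcoeff_msupp; apply: contraNneq nz => ->; rewrite mul0rn.
by rewrite /= mdegD mdeg1 addn1 => -[].
Qed.

Definition radial_free W : Prop := \sum_(i < n) ('X_i : {mpoly C[n]})%:MP * mderiv i W = 0.

Lemma radial_free_mderiv W j : radial_free W -> radial_free (mderiv j W).
Proof.
move=> /(congr1 (mderiv j)); rewrite raddf0 raddf_sum /radial_free => e.
rewrite -[RHS]e; apply: eq_bigr => i _.
by rewrite /= mderivM mderivC mul0r add0r mderiv_comm.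
Qed.

(** The derivative in [t] of [W(x, v + t x)] is the contraction of [W] with the radial field, so
    this polynomial in [t] is constant. *)
Lemma eval2_shift W x v t : radial_free W ->
  eval2 W x (fun i => v i + t * x i) = eval2 W x v.
Proof.
move=> rW; pose F : {rmorphism {mpoly {mpoly C[n]}[n]} -> {poly C}} :=
  mmap (@polyC C \o meval x) (fun i => (v i)%:P + (x i)%:P * 'X).
have FC c : F c%:MP = (c.@[x])%:P by exact: mmapC.
have FX i : F 'X_i = (v i)%:P + (x i)%:P * 'X by rewrite /F /= mmapX mmap1U.
have Ft s : (F W).[s] = eval2 W x (fun i => v i + s * x i).
  move: W {rW}; apply: (mpoly_rmorph_ext (F := horner_eval s \o F)
    (G := mmap (meval x) (fun i => v i + s * x i))) => [c|i] /=.
    by rewrite FC mmapC /horner_eval hornerC.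
  rewrite FX mmapX mmap1U /horner_eval hornerD hornerM !hornerC hornerX.
  by rewrite mulrC.
have dF : deriv (F W) = 0.
  have := @mderivation_chain n _ _ F (fun P => deriv (F P)).
  move=> -> /=; last 2 first.
  - by move=> P Q; rewrite rmorphD derivD.
  - by move=> P Q; rewrite rmorphM derivM; ring.
  rewrite big1 ?add0r => [|m _]; last by rewrite FC derivC mul0r.
  rewrite -[RHS](raddf0 F) -[in RHS]rW (raddf_sum F); apply: eq_bigr => i _.
  rewrite /= FX rmorphM /= FC mevalXU derivD derivC add0r derivM derivC derivX.
  by rewrite mul0r add0r mulr1 mulrC.
rewrite -Ft (deriv_eq0_const t dF) Ft; congr (eval2 W x _).
by apply/funext => i; rewrite mul0r addr0.
Qed.

Lemma eval2_diag k W x : radial_free W -> W \is k.+1.-homog -> eval2 W x x = 0.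
Proof.
move=> rW hW; have := eval2_homog_snd x x 0 hW.
rewrite exprS !mul0r => <-; rewrite -[RHS](eval2_shift _ _ 1 rW).
by congr (eval2 W x _); apply/funext => i; rewrite mul0r add0r mul1r.
Qed.

(** The polar with center [x] is singular at [x]. Differentiating [W(z, z) = 0] along the [l]-th
    axis gives this derivative plus a derivative in the second group; the latter is again
    radial-free, of positive degree [k.+1], and so vanishes on the diagonal. *)
Lemma eval2_mderiv_coef_diag k W x l : radial_free W -> W \is k.+2.-homog ->
  eval2 (mderiv_coef l W) x x = 0.
Proof.
move=> rW hW; pose h i : {poly C} := (x i)%:P + (i == l)%:R%:P * 'X.
pose F : {rmorphism {mpoly {mpoly C[n]}[n]} -> {poly C}} := mmap (mmap (@polyC C) h) h.
have FC c : F c%:MP = mmap (@polyC C) h c by exact: mmapC.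
have FX i : F 'X_i = h i by rewrite /F /= mmapX mmap1U.
have hC s (c : {mpoly C[n]}) : (mmap (@polyC C) h c).[s] = c.@[fun i => (h i).[s]].
  move: c; apply: (mpoly_rmorph_ext (F := horner_eval s \o mmap (@polyC C) h)
    (G := meval _)) => [c|i] /=; first by rewrite mmapC mevalC /horner_eval hornerC.
  by rewrite mmapX mmap1U mevalXU.
have Ft s V : (F V).[s] = eval2 V (fun i => (h i).[s]) (fun i => (h i).[s]).
  move: V; apply: (mpoly_rmorph_ext (F := horner_eval s \o F)
    (G := mmap (meval _) _)) => [c|i] /=.
    by rewrite FC mmapC /horner_eval hC.
  by rewrite FX mmapX mmap1U.
have FW : F W = 0.
  by apply: poly_eq0_horner => s; rewrite Ft (eval2_diag _ rW hW).
have h0 : (fun i => (h i).[0]) = x.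
  by apply/funext => i; rewrite /h hornerD hornerM !hornerC hornerX mulr0 addr0.
have e : deriv (F W) = \sum_l F (mderiv_coef l W) * deriv (F ('X_l)%:MP)
                   + \sum_i F (mderiv i W) * deriv (F 'X_i).
  apply: (mderivation_chain2 (D := fun P => deriv (F P))) => [P Q|P Q|c].
  - by rewrite rmorphD derivD.
  - by rewrite rmorphM derivM; ring.
  by rewrite FC mmapC derivC.
have dh i : deriv (h i) = (i == l)%:R%:P.
  by rewrite /h derivD derivC add0r derivM derivC derivX mul0r add0r mulr1.
have {e} := congr1 (fun P : {poly C} => P.[0]) e.
rewrite /= FW deriv0 hornerD !horner_sum horner0.
rewrite (bigD1 l) //= [X in _ + X + _]big1 => [|i nil]; last first.
  by rewrite FC mmapX mmap1U dh (negbTE nil) mulr0 horner0.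
rewrite [X in _ + X]big1 => [|i _]; last first.
  by rewrite hornerM Ft h0 (eval2_diag _ (radial_free_mderiv i rW) (mderiv_homog i hW)) mul0r.
rewrite !addr0 FC mmapX mmap1U dh eqxx mulr1 Ft h0.
by [].
Qed.

End TwoVariableGroups.

(** * Generic points over a countable ring of coefficients *)

Section Coefficients.
Variables (R : realType).
Local Notation C := (Cplx R).

(** The ring is a polynomial ring over the integers with one variable for each entry of [s]. Its map
    to [C] need not be injective, which is why kernels are tracked throughout. *)
Lemma countable_coef_ring (s : seq C) : exists (A : comNzRingType) (ka : {rmorphism A -> C}),
  countable [set: A] /\ forall c, c \in s -> exists a, ka a = c.
Proof.
exists {mpoly int[size s]}, (mmap intr (tnth (in_tuple s))); split.
  by apply: countable_mpoly; exact: countableP.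
move=> c /(tnthP (in_tuple s))[i ->]; exists 'X_i.
by rewrite /= mmapX mmap1U.
Qed.

Lemma lift_mpoly (A B : nzRingType) (f : {rmorphism A -> B}) n (P : {mpoly B[n]}) :
  (forall m, m \in msupp P -> exists a, f a = P@_m) ->
  exists Q, map_mpoly f Q = P.
Proof.
move=> fP; have /choice[g gP] m : exists a, m \in msupp P -> f a = P@_m.
  have [/fP[a <-]|] := boolP (m \in msupp P); first by exists a.
  by exists 0.
exists (\sum_(m <- msupp P) g m *: 'X_[m]).
rewrite raddf_sum [RHS]mpolyE; apply: eq_big_seq => m mP /=.
by rewrite map_mpolyZ map_mpolyX gP.
Qed.

Lemma map_mpoly_mderiv n (A B : nzRingType) (f : {rmorphism A -> B}) i (P : {mpoly A[n]}) :
  map_mpoly f (mderiv i P) = mderiv i (map_mpoly f P).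
Proof.
by apply/mpolyP => m; rewrite mcoeff_map_mpoly !mcoeff_mderiv raddfMn mcoeff_map_mpoly.
Qed.

Lemma map_mpoly_mderiv_coef n (A B : comNzRingType) (f : {rmorphism A -> B}) l
    (W : {mpoly {mpoly A[n]}[n]}) :
  map_mpoly (map_mpoly f) (mderiv_coef l W) = mderiv_coef l (map_mpoly (map_mpoly f) W).
Proof.
have coefE (D : comNzRingType) (V : {mpoly {mpoly D[n]}[n]}) m :
  (mderiv_coef l V)@_m = mderiv l V@_m by exact: mcoeff_map_mpoly.
apply/mpolyP => m; transitivity (map_mpoly f (mderiv_coef l W)@_m).
  exact: mcoeff_map_mpoly.
rewrite coefE map_mpoly_mderiv; apply/esym/(etrans (coefE _ _ _)).
by congr (mderiv l _); exact: mcoeff_map_mpoly.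
Qed.

Lemma meval_map_mpoly n (A : comNzRingType) (ka : {rmorphism A -> C}) (P : {mpoly A[n]}) v :
  (map_mpoly ka P).@[v] = mmap ka v P.
Proof.
move: P; apply: (mpoly_rmorph_ext (F := meval v \o map_mpoly ka) (G := mmap ka v)).
  by move=> c /=; rewrite map_mpolyC mevalC mmapC.
by move=> i /=; rewrite map_mpolyX mevalXU mmapX mmap1U.
Qed.

Section GenericPoints.
Variables (n : nat) (A : comNzRingType) (ka : {rmorphism A -> C}).
Hypothesis countableA : countable [set: A].

Definition generic_point (q : 'I_n -> C) : Prop :=
  forall P : {mpoly A[n]}, mmap ka q P = 0 -> map_mpoly ka P = 0.

(** Scaling [v] by [t] multiplies the component of degree [d] by [t ^+ (k * d)]; as [k] is positive,
    these powers separate the components. This matters because a projective closure only knows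
    homogeneous relations. *)
Lemma homog_relation N k (a : 'I_N -> {mpoly C[n]}) (P : {mpoly C[N]}) :
  (0 < k)%N -> (forall j, a j \is k.-homog) ->
  (forall v, P.@[fun j => (a j).@[v]] = 0) ->
  forall e v, (pihomog mdeg e P).@[fun j => (a j).@[v]] = 0.
Proof.
(* The bound also exceeds [e], so that the component of degree [e] occurs in the sum even if it is
   zero. *)
move=> k_gt0 ha P0 e v; pose s := maxn (msize P) e.+1.
have sP : (msize P <= s)%N by rewrite leq_maxl.
pose T : {poly C} := \sum_(d < s) ((pihomog mdeg d P).@[fun j => (a j).@[v]])%:P * 'X^(k * d).
have T0 : T = 0.
  apply: poly_eq0_horner => t; rewrite -(P0 (fun i => t * v i)).
  rewrite [P in RHS](pihomog_partitionE sP) raddf_sum /= horner_sum.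
  apply: eq_bigr => d _; rewrite hornerM hornerC hornerXn exprM mulrC.
  rewrite -(mmap_homog idfun) ?pihomogP //; apply: meval_eq => j.
  by rewrite -(mmap_homog idfun).
have e_s : (e < s)%N by rewrite leq_maxr.
have := congr1 (fun Q : {poly C} => Q`_(k * e)) T0.
rewrite /= coef0 coef_sum (bigD1 (Ordinal e_s)) //= big1 => [|d neq_d].
  by rewrite addr0 coefCM coefXn eqxx mulr1.
rewrite coefCM coefXn eqn_mul2l eqn0Ngt k_gt0 /=.
case: eqP => [ed|_]; last by rewrite mulr0.
by case/eqP: neq_d; apply: val_inj.
Qed.

(** The values of [a] and [b] at [q] satisfy the same relations over [A]: a relation at the generic
    point [q] holds identically, hence so does each homogeneous component, and these pass from one
    family to the other. *)
Lemma generic_pair N k (a b : 'I_N -> {mpoly A[n]}) (q : 'I_n -> C) :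
  (0 < k)%N -> generic_point q ->
  (forall j, map_mpoly ka (a j) \is k.-homog) ->
  (forall j, map_mpoly ka (b j) \is k.-homog) ->
  (forall e (Q : {mpoly C[N]}), Q \is e.-homog ->
    (forall v, Q.@[fun j => mmap ka v (a j)] = 0) -> Q.@[fun j => mmap ka q (b j)] = 0) ->
  (forall e (Q : {mpoly C[N]}), Q \is e.-homog ->
    (forall v, Q.@[fun j => mmap ka v (b j)] = 0) -> Q.@[fun j => mmap ka q (a j)] = 0) ->
  exists2 p, generic_point p & forall j, mmap ka p (a j) = mmap ka q (b j).
Proof.
move=> k_gt0 gq ha hb Hab Hba.
pose f (c : 'I_N -> {mpoly A[n]}) : {rmorphism {mpoly A[N]} -> C} :=
  mmap ka (fun j => mmap ka q (c j)).
have ker_sub (c d : 'I_N -> {mpoly A[n]}) :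
    (forall j, map_mpoly ka (c j) \is k.-homog) ->
    (forall e (Q : {mpoly C[N]}), Q \is e.-homog ->
      (forall v, Q.@[fun j => mmap ka v (c j)] = 0) ->
      Q.@[fun j => mmap ka q (d j)] = 0) ->
    forall P, f c P = 0 -> f d P = 0.
  move=> hc Hcd P fP0.
  have compE v : mmap ka v (mmap (@mpolyC n A) c P)
      = (map_mpoly ka P).@[fun j => (map_mpoly ka (c j)).@[v]].
    move: P {fP0}; apply: (mpoly_rmorph_ext
      (F := mmap ka v \o mmap (@mpolyC n A) c)
      (G := meval (fun j => (map_mpoly ka (c j)).@[v]) \o map_mpoly ka)) => [x|j] /=.
      by rewrite !mmapC map_mpolyC mevalC.
    by rewrite mmapX mmap1U map_mpolyX mevalXU meval_map_mpoly.
  have PcE v : (map_mpoly ka P).@[fun j => (map_mpoly ka (c j)).@[v]] = 0.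
    rewrite -compE -meval_map_mpoly gq ?raddf0 // compE -fP0 /= meval_map_mpoly.
    by congr (mmap ka _ P); apply/funext => j; rewrite meval_map_mpoly.
  rewrite /= -meval_map_mpoly (pihomog_partitionE (leqnn (msize (map_mpoly ka P)))).
  rewrite raddf_sum big1 //= => e _; apply: (Hcd e); first exact: pihomogP.
  move=> v; rewrite -[RHS](homog_relation k_gt0 hc PcE e v).
  by apply: meval_eq => j; rewrite meval_map_mpoly.
have fab : same_kernel (f a) (f b).
  by move=> P; split; [apply: (ker_sub a b ha Hab)|apply: (ker_sub b a hb Hba)].
(* The isomorphism sending [a(q)] to [b(q)] is extended to the coordinates of [q], whose images form
   [p]. Hence [p] is generic, and the relation expressing [a(q)] through [q] becomes
   [b(q) = a(p)]. *)
have [p kp] := same_kernel_mpoly q (countable_mpoly N countableA) fab.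
have liftE c (h : 'I_n -> C) P : mmap (f c) h (map_mpoly (@mpolyC N A) P) = mmap ka h P.
  move: P; apply: (mpoly_rmorph_ext
    (F := mmap (f c) h \o map_mpoly (@mpolyC N A)) (G := mmap ka h)) => [x|j] /=.
    by rewrite map_mpolyC !mmapC; apply: mmapC.
  by rewrite map_mpolyX !mmapX !mmap1U.
exists p => [P P0|j]; first by apply: gq; rewrite -(liftE a) kp liftE.
have := kp (('X_j)%:MP - map_mpoly (@mpolyC N A) (a j)).
rewrite !raddfB /= !mmapC !liftE /= !mmapX !mmap1U subrr => -[/(_ erefl) + _].
by move/eqP; rewrite subr_eq0 => /eqP ->.
Qed.

(* Move [p] in an arbitrary direction and let the singular point [q] of the
   curve [W(x, p) = 0] follow it. *)
Lemma generic_tangency (W : {mpoly {mpoly A[n]}[n]}) (p q : 'I_n -> C) :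
  generic_point p -> eval2 (map_mpoly (map_mpoly ka) W) q p = 0 ->
  (forall l, eval2 (mderiv_coef l (map_mpoly (map_mpoly ka) W)) q p = 0) ->
  forall i, eval2 (mderiv i (map_mpoly (map_mpoly ka) W)) q p = 0.
Proof.
move=> gp W0 dW0 i; pose D0 (P : {mpoly A[n]}) := mmap ka p (mderiv i P).
have tD0 : tangent (mmap ka p) D0.
  split=> [P Q|P Q|P P0]; rewrite /D0; first by rewrite mderivD raddfD.
    by rewrite mderivM rmorphD !rmorphM /=; ring.
  by rewrite -meval_map_mpoly map_mpoly_mderiv (gp _ P0) !raddf0.
have [D [DD DM Dk] DC] := tangent_mpoly (f := mmap ka p) q tD0.
pose F : {rmorphism {mpoly {mpoly A[n]}[n]} -> C} := mmap (mmap ka p) q.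
have FC c : F c%:MP = mmap ka p c by exact: mmapC.
have FX l : F 'X_l = q l by rewrite /F /= mmapX mmap1U.
(* The direction of [p] is chosen first and that of [q] depends on it, so [p] has to sit in the
   coefficients. In [W] the roles are the opposite, whence the exchange of the two groups. *)
pose swap : {rmorphism {mpoly {mpoly A[n]}[n]} -> {mpoly {mpoly A[n]}[n]}} :=
  mmap (mmap (@mpolyC n _ \o @mpolyC n A) (fun l => 'X_l)) (fun j => ('X_j)%:MP).
have swapC c : swap c%:MP = mmap (@mpolyC n _ \o @mpolyC n A) (fun l => 'X_l) c.
  by exact: mmapC.
have swapX j : swap 'X_j = ('X_j)%:MP by rewrite /swap /= mmapX mmap1U.
have Fswap V : F (swap V) = eval2 (map_mpoly (map_mpoly ka) V) q p.
  move: V; apply: (mpoly_rmorph_ext (F := F \o swap)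
    (G := mmap (meval q) p \o map_mpoly (map_mpoly ka))) => [c|j] /=.
    rewrite swapC map_mpolyC [RHS]mmapC /= meval_map_mpoly.
    move: c; apply: (mpoly_rmorph_ext (F := F \o mmap _ _) (G := mmap ka q)) => [c|l] /=.
      by rewrite mmapC /= FC !mmapC.
    by rewrite mmapX mmap1U FX mmapX mmap1U.
  by rewrite swapX map_mpolyX FC !mmapX !mmap1U.
pose G : {rmorphism {mpoly {mpoly A[n]}[n]} -> C} := F \o swap.
have GE V : G V = eval2 (map_mpoly (map_mpoly ka) V) q p by exact: Fswap.
have GDD P Q : D (swap (P + Q)) = D (swap P) + D (swap Q) by rewrite rmorphD DD.
have GDM P Q : D (swap (P * Q)) = G P * D (swap Q) + G Q * D (swap P).
  by rewrite rmorphM DM.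
have GDC c : D (swap c%:MP%:MP) = 0 by rewrite swapC mmapC DC /D0 mderivC raddf0.
(* The relation [W(q, p) = 0] persists to first order. In its expansion the motion of [q]
   contributes nothing, the derivatives in [x] being zero; only the [i]-th derivative in the second
   group remains. *)
have DW : D (swap W) = 0 by apply: Dk; apply: etrans (Fswap W) W0.
have S1 : \sum_l G (mderiv_coef l W) * D (swap ('X_l)%:MP) = 0.
  by apply: big1 => l _; rewrite GE map_mpoly_mderiv_coef dW0 mul0r.
have DX j : D (swap 'X_j) = (j == i)%:R.
  rewrite swapX DC /D0 mderivX mnm1E; case: eqP => [->|_]; last first.
    by rewrite scale0r raddf0.
  rewrite scale1r (_ : (U_(i) - U_(i))%MM = 0%MM) ?mpolyX0 ?rmorph1 //.
  by apply/mnmP=> l; rewrite mnmBE subnn mnm0E.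
have S2 : \sum_j G (mderiv j W) * D (swap 'X_j) = G (mderiv i W).
  rewrite (bigD1 i) //= big1 => [|j /negbTE ji]; first by rewrite DX eqxx mulr1 addr0.
  by rewrite DX ji mulr0.
have e : D (swap W) = \sum_l G (mderiv_coef l W) * D (swap ('X_l)%:MP)
                      + \sum_j G (mderiv j W) * D (swap 'X_j).
  exact: (mderivation_chain2 GDD GDM GDC).
transitivity (G (mderiv i W)); first by rewrite GE map_mpoly_mderiv.
apply: etrans (etrans (esym e) DW).
exact: etrans (esym (add0r _)) (esym (congr2 +%R S1 S2)).
Qed.

End GenericPoints.
End Coefficients.

(** * Double lines and square-free germs *)

Lemma size_polyM_bound (B : nzRingType) (p q : {poly B}) a b :
  (size p <= a.+1)%N -> (size q <= b.+1)%N -> (size (p * q)%R <= (a + b).+1)%N.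
Proof.
move=> sp sq; apply: leq_trans (size_polyMleq _ _) _.
by move: sp sq; move: (size p) (size q) => x y; lia.
Qed.

Section BinaryForms.
Variables (C : numClosedFieldType) (e : 'I_2).

(* The point (t : 1) of the projective line if [e] is the last index. *)
Definition line_point (B : nzRingType) (t : B) (j : 'I_2) : B := if j == e then 1 else t.

(** The binary form of degree [d] that restricts to [p] where the variable of index [e] is 1. *)
Definition homogenize d (p : {poly C}) : {mpoly C[2]} :=
  \sum_(t < d.+1) p`_t *: ('X_(lift e ord0) ^+ t * 'X_e ^+ (d - t)).

Lemma ord2P (j : 'I_2) : j = e \/ j = lift e ord0.
Proof.
by have [i ->|->] := unliftP e j; [right; congr lift; apply: ord_inj; case: i => -[] | left].
Qed.

Lemma homogenize_eval d (p : {poly C}) t s : (size p <= d.+1)%N ->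
  (homogenize d p).@[fun j => s * line_point t j] = s ^+ d * p.[t].
Proof.
move=> sp; rewrite (horner_coef_wide _ sp) mulr_sumr raddf_sum.
apply: eq_bigr => i _ /=; rewrite mevalZ mevalM !rmorphXn /= !mevalXU /line_point.
rewrite eqxx [lift e ord0 == e]eq_sym (negbTE (neq_lift _ _)) mulr1 exprMn.
have -> : s ^+ d = s ^+ i * s ^+ (d - i) by rewrite -exprD subnKC // -ltnS.
by ring.
Qed.

(** The points tested are dense: outside the line [v e = 0] every point has this shape, and a factor
    ['X_e] disposes of that line. *)
Lemma mpoly2_eq (P Q : {mpoly C[2]}) :
  (forall s t, P.@[fun j => s * line_point t j] = Q.@[fun j => s * line_point t j]) ->
  P = Q.
Proof.
move=> PQ; apply/eqP; rewrite -subr_eq0; apply/eqP.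
have nzX : ('X_e : {mpoly C[2]}) != 0.
  by rewrite -msize_poly_eq0 msizeX.
apply: (mulfI nzX); rewrite mulr0; apply: mpoly_eq0_meval => v.
rewrite mevalM mevalXU mevalB; have [->|nz] := eqVneq (v e) 0; first by rewrite mul0r.
suff -> : v = (fun j => v e * line_point (v (lift e ord0) / v e) j).
  by rewrite PQ subrr mulr0.
apply/funext => j; rewrite /line_point; have [->|->] := ord2P j.
  by rewrite eqxx mulr1.
by rewrite eq_sym (negbTE (neq_lift _ _)) mulrC divfK.
Qed.

Lemma homogenizeM d1 d2 (p q : {poly C}) :
  (size p <= d1.+1)%N -> (size q <= d2.+1)%N ->
  homogenize (d1 + d2) (p * q) = homogenize d1 p * homogenize d2 q.
Proof.
move=> sp sq; apply: mpoly2_eq => s t.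
rewrite mevalM !homogenize_eval //; first by rewrite hornerM exprD; ring.
exact: size_polyM_bound.
Qed.

Lemma homogenizeZ d a (p : {poly C}) : homogenize d (a *: p) = a *: homogenize d p.
Proof.
by rewrite /homogenize scaler_sumr; apply: eq_bigr => t _; rewrite coefZ scalerA.
Qed.

Lemma homogenize_coef d (p : {poly C}) m : (homogenize d p)@_m =
  \sum_(t < d.+1) p`_t * ('X_(lift e ord0) ^+ t * 'X_e ^+ (d - t) : {mpoly C[2]})@_m.
Proof. by rewrite raddf_sum; apply: eq_bigr => t _; apply: mcoeffZ. Qed.

Lemma msize_homogenize d (p : {poly C}) : (msize (homogenize d p) <= d.+1)%N.
Proof.
apply: leq_trans (msize_sum _ _ _) _; apply/bigmax_leqP => t _.
apply: leq_trans (msizeZ_le _ _) _.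
by rewrite !mpolyXn -mpolyXD msizeX mdegD !mdegMn !mdeg1 !mul1n subnKC // -ltnS.
Qed.

Lemma homogenize_meval0 d (p : {poly C}) : (0 < d)%N ->
  (homogenize d p).@[fun=> 0] = 0.
Proof.
move=> d_gt0; rewrite raddf_sum big1 // => t _ /=.
rewrite mevalZ mevalM !rmorphXn /= !mevalXU -exprD subnKC; last by rewrite -ltnS.
by rewrite expr0n gtn_eqF // mulr0.
Qed.

End BinaryForms.

Section Holomorphic.
Variable R : realType.
Local Notation C := (Cplx R).

Lemma holo_mul (f g : 'rV[C]_2 -> C) y : differentiable f y -> differentiable g y ->
  differentiable (fun z => f z * g z) y.
Proof. exact: (@differentiableM C 'rV[C]_2 f g). Qed.

Lemma holo_sum (I : Type) (r : seq I) (f : I -> 'rV[C]_2 -> C) y :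
  (forall i, differentiable (f i) y) -> differentiable (fun z => \sum_(i <- r) f i z) y.
Proof.
move=> df; elim: r => [|i r IHr].
  under eq_fun do rewrite big_nil; exact: differentiable_cst.
under eq_fun do rewrite big_cons; exact: (@differentiableD C 'rV[C]_2 C (f i)).
Qed.

Lemma holo_meval n (h : 'rV[C]_2 -> 'I_n -> C) (G : {mpoly C[n]}) y :
  (forall j, differentiable (fun z => h z j) y) ->
  differentiable (fun z => G.@[h z]) y.
Proof.
move=> dh; under eq_fun do rewrite mevalE.
apply: holo_sum => m; apply: holo_mul; first exact: differentiable_cst.
elim: (index_enum _) => [|i r IHr].
  under eq_fun do rewrite big_nil; exact: differentiable_cst.
under eq_fun do rewrite big_cons; apply: holo_mul => //.
elim: (m i) => [|d IHd]; first exact: differentiable_cst.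
by under eq_fun do rewrite exprS; apply: holo_mul.
Qed.

Lemma poly_germ_homogenize e d (y0 : 'rV[C]_2) (p : 'rV[C]_2 -> {poly C}) :
  (forall t, \forall y \near y0, differentiable (fun z => (p z)`_t) y) ->
  poly_germ y0 (fun y => homogenize e d (p y)).
Proof.
move=> dp; split; first by exists d.+1; near=> y; exact: msize_homogenize.
move=> m.
have FF : Filter (nbhs y0) by exact: nbhs_filter.
have dall := @filter_forall _ 'I_d.+1 (fun t y =>
  differentiable (fun z => (p z)`_t) y) (nbhs y0) FF (fun t => dp t).
refine (@filterS _ (nbhs y0) FF _ _ _ dall) => y dy.
under eq_fun do rewrite homogenize_coef.
apply: holo_sum => t; apply: holo_mul => //; exact: differentiable_cst.
Unshelve. all: by end_near.
Qed.

End Holomorphic.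

Lemma size_square_factor (D : idomainType) (c : D) (p m n : {poly D}) :
  c != 0 -> p != 0 -> c *: p = n * m ^+ 2 ->
  (size n + 2 * (size m).-1)%N = size p /\ (0 < size n)%N.
Proof.
move=> nzc nzp e; have nz : n * m ^+ 2 != 0 by rewrite -e scale_poly_eq0 negb_or nzc.
have nzn : n != 0 by apply: contraNneq nz => ->; rewrite mul0r.
have nzm : m != 0 by apply: contraNneq nz => ->; rewrite expr0n mulr0.
rewrite size_poly_gt0 nzn -(size_scale p nzc) e expr2 !size_mul ?mulf_neq0 //.
move: nzn nzm; rewrite -!size_poly_gt0.
by case: (size n) (size m) => [|a] [|b] // _ _; split=> //=; lia.
Qed.

Section DoubleLine.
Variables (R : realType) (A : comNzRingType).
Local Notation C := (Cplx R).
Variable ka : {rmorphism A -> C}.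

(** A tangent vector of the chart [i], lifted to the cone: its [i]-th component is zero because
    [dX_i = 0] there. *)
Definition chart_vec (B : nzRingType) (i : 'I_3) (z : 'I_2 -> B) (j : 'I_3) : B :=
  oapp z 0 (unlift i j).

Lemma size_dehomogenize (B : comNzRingType) n k (h : 'I_n -> {poly B}) (W : {mpoly B[n]}) :
  (forall j, (size (h j) <= 2)%N) -> W \is k.-homog ->
  (size (mmap (@polyC B) h W) <= k.+1)%N.
Proof.
move=> sh /dhomogP hW; rewrite /mmap big_seq.
apply: (big_ind (fun p : {poly B} => (size p <= k.+1)%N)) => [|p q sp sq|m /hW <-].
- by rewrite size_poly0.
- by rewrite (leq_trans (size_polyD _ _)) // geq_max sp sq.
rewrite mul_polyC; apply: leq_trans (size_scale_leq _ _) _.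
rewrite /= mdegE /mmap1.
elim/big_ind2: _ => [|p a q b sp sq|j _]; first by rewrite size_poly1.
  exact: size_polyM_bound.
apply: leq_trans (size_poly_exp_leq _ _) _; rewrite ltnS.
by rewrite -[leqRHS]mul1n leq_mul2r; have := sh j; case: size => [|[|[]]] //; rewrite ?orbT.
Qed.

Lemma chart_form_eval (W : {mpoly {mpoly C[3]}[3]}) i y (z : 'I_2 -> C) :
  (chart_form W i y).@[z] = eval2 W (fun j => chart i y 0 j) (chart_vec i z).
Proof.
rewrite /chart_form comp_mpoly_meval /eval_fst eval2_fst.
congr (eval2 W _ _); apply/funext => j; rewrite tnth_mktuple /chart_vec.
by case: unliftP => [m _|_] /=; rewrite ?mevalXU // raddf0.
Qed.

Lemma generic_no_double_line (W : {mpoly {mpoly A[3]}[3]}) k N (q : 'rV[C]_3)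
    (p : 'I_3 -> C) (WC := map_mpoly (map_mpoly ka) W) :
  generic_point ka (fun j => q 0 j) ->
  WC \is k.+1.-homog -> (forall u, WC@_u \is N.-homog) -> radial_free WC ->
  smooth_point k.+1 WC q -> eval2 WC (fun j => q 0 j) p = 0 ->
  (forall i, eval2 (mderiv i WC) (fun j => q 0 j) p = 0) ->
  exists t, forall j, p j = t * q 0 j.
Proof.
set qf := fun j => q 0 j; move=> gq hW hN rW [_ nsing [i [nzqi sqf _]]] Wp dWp.
(* By shift invariance [p] may be replaced by a vector tangent to the chart; it is zero exactly when
   [p] is a multiple of [q]. If it is not, its slope [lam] will be a double root of the
   dehomogenized form at [q]. *)
pose v j := p j - (p i / q 0 i) * q 0 j.
have vi : v i = 0 by rewrite /v divfK // subrr.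
have shiftv V : radial_free V -> eval2 V qf v = eval2 V qf p.
  move=> rV; rewrite -(eval2_shift qf p (- (p i / q 0 i)) rV).
  by congr (eval2 V qf _); apply/funext => j; rewrite /v mulNr.
have [v0|/existsNP[e /eqP nzve]] := pselect (forall m, v (lift i m) = 0).
  exists (p i / q 0 i) => j; apply/eqP; rewrite -subr_eq0; apply/eqP.
  by rewrite -/(v j); case: (unliftP i j) => [m ->|->].
exfalso; pose lam := v (lift i (lift e ord0)) / v (lift i e).
have vE : v = (fun j => v (lift i e) * chart_vec i (line_point e lam) j).
  apply/funext => j; rewrite /chart_vec; case: unliftP => [m ->|->] /=; last first.
    by rewrite mulr0.
  rewrite /line_point; have [->|->] := ord2P e m; first by rewrite eqxx mulr1.
  by rewrite eq_sym (negbTE (neq_lift _ _)) mulrC divfK.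
have root_of d V : radial_free V -> V \is d.-homog -> eval2 V qf p = 0 ->
    eval2 V qf (chart_vec i (line_point e lam)) = 0.
  move=> rV hV Vp; have := shiftv _ rV; rewrite Vp vE (eval2_homog_snd _ _ _ hV).
  by move/eqP; rewrite mulf_eq0 expf_eq0 (negbTE nzve) andbF => /eqP.
pose h (B : comNzRingType) := chart_vec i (line_point e ('X : {poly B})).
pose f : {rmorphism {mpoly A[3]} -> C} := mmap ka qf.
pose rho : {rmorphism {mpoly A[3]} -> {mpoly C[3]}} := map_mpoly ka.
have fE x : f x = (rho x).@[qf] by rewrite meval_map_mpoly.
have [deh [dehC dehX]] : exists deh : {rmorphism {mpoly {mpoly A[3]}[3]} -> {poly {mpoly A[3]}}},
    (forall c, deh c%:MP = c%:P) /\ (forall j, deh 'X_j = h _ j).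
  exists (mmap (@polyC _) (h _)); split=> [c|j]; first by exact: mmapC.
  by rewrite /= mmapX mmap1U.
have hE (B D : comNzRingType) (g : {rmorphism B -> D}) j : map_poly g (h B j) = h D j.
  rewrite /h /chart_vec; case: unliftP => [m _|_] /=; last by rewrite raddf0.
  by rewrite /line_point; case: eqP => _; rewrite ?rmorph1 ?map_polyX.
have hx t j : (h C j).[t] = chart_vec i (line_point e t) j.
  rewrite /h /chart_vec; case: unliftP => [m _|_] /=; last by rewrite horner0.
  by rewrite /line_point; case: eqP => _; rewrite ?hornerC ?hornerX.
have dehE V x t : (map_poly (mmap ka x) (deh V)).[t] =
    eval2 (map_mpoly (map_mpoly ka) V) x (chart_vec i (line_point e t)).
  move: V; apply: (mpoly_rmorph_ext
    (F := horner_at (mmap ka x) t \o deh)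
    (G := mmap (meval x) (chart_vec i (line_point e t)) \o map_mpoly (map_mpoly ka)))
    => [c|j] /=.
    rewrite dehC map_mpolyC [RHS]mmapC /= meval_map_mpoly /horner_at /horner_morph.
    by rewrite map_polyC hornerC.
  by rewrite dehX /horner_at /horner_morph hE hx // map_mpolyX mmapX mmap1U.
pose P := deh W.
have rP : root (map_poly f P) lam by rewrite /root dehE (root_of _ _ rW hW Wp).
have rP' : root (deriv (map_poly f P)) lam.
  have [F1 F1E] : exists F1 : {rmorphism {mpoly {mpoly A[3]}[3]} -> {poly C}},
      forall V, F1 V = map_poly f (deh V) by exists (map_poly f \o deh).
  have F1C c : F1 c%:MP = (f c)%:P by rewrite F1E dehC map_polyC.
  have F1DD V1 V2 : deriv (F1 (V1 + V2)) = deriv (F1 V1) + deriv (F1 V2).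
    by rewrite rmorphD derivD.
  have F1DM V1 V2 : deriv (F1 (V1 * V2)) = F1 V1 * deriv (F1 V2) + F1 V2 * deriv (F1 V1).
    by rewrite rmorphM derivM addrC; congr (_ + _); exact: mulrC.
  have -> : deriv (map_poly f P) = \sum_(m <- msupp W) deriv (F1 (W@_m)%:MP) * F1 'X_[m]
                  + \sum_j F1 (mderiv j W) * deriv (F1 'X_j).
    by rewrite -F1E; exact: (mderivation_chain F1DD F1DM W).
  rewrite big1 ?add0r => [|m _]; last by rewrite F1C derivC mul0r.
  rewrite /root horner_sum big1 // => j _; rewrite hornerM.
  suff -> : (F1 (mderiv j W)).[lam] = 0 by rewrite mul0r.
  rewrite F1E dehE map_mpoly_mderiv.
  by apply: (root_of k); [exact: radial_free_mderiv|exact: mderiv_homog|exact: dWp].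
pose PC := map_poly rho P.
have PCE x : map_poly (meval x) PC = map_poly (mmap ka x) P.
  by apply/polyP => t; rewrite !coef_map /= meval_map_mpoly.
have sPC : (size PC <= k.+2)%N.
  have dehPC V : map_poly rho (deh V) = mmap (@polyC _) (h _) (map_mpoly (map_mpoly ka) V).
    move: V; apply: (mpoly_rmorph_ext (F := map_poly rho \o deh)
      (G := mmap (@polyC _) (h _) \o map_mpoly (map_mpoly ka))) => [c|j] /=.
      by rewrite dehC map_polyC map_mpolyC [RHS]mmapC.
    by rewrite dehX hE map_mpolyX mmapX mmap1U.
  rewrite /PC /P dehPC.
  apply: size_dehomogenize => // j; rewrite /h /chart_vec.
  case: unliftP => [m _|_] /=; last by rewrite size_poly0.
  by rewrite /line_point; case: eqP => _; rewrite ?size_poly1 ?size_polyX.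
(* The representative of the point [y] of the chart is rescaled so that the center [y0] gives
   exactly the generic coordinates of [q]. *)
pose X (y : 'rV[C]_2) (j : 'I_3) : C := q 0 i * chart i y 0 j.
have chart_formE y : chart_form WC i y =
    (q 0 i)^-1 ^+ N *: homogenize e k.+1 (map_poly (meval (X y)) PC).
  apply: (mpoly2_eq (e := e)) => s t.
  rewrite mevalZ homogenize_eval; last exact: leq_trans (size_poly _ _) sPC.
  rewrite PCE dehE -/WC.
  have -> u : eval2 WC (X y) u = q 0 i ^+ N * eval2 WC (fun j => chart i y 0 j) u.
    exact: eval2_homog_fst.
  rewrite [RHS]mulrCA (mulrA (_^-1 ^+ N)) -exprMn mulVf // expr1n mul1r.
  rewrite -(eval2_homog_snd _ _ _ hW) chart_form_eval.
  congr (eval2 WC _ _); apply/funext => j; rewrite /chart_vec.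
  by case: unliftP => [m _|_] //=; rewrite mulr0.
pose y0 := chart_coord i q.
have X0 : X y0 = qf.
  apply/funext => j; rewrite /X mxE; case: unliftP => [m ->|->] /=; last first.
    by rewrite mulr1.
  by rewrite mxE mulrC divfK.
have nzP : map_poly f P != 0.
  apply/eqP => P0; apply: nsing; apply: mpoly_eq0_meval => u.
  have c0 : chart_form WC i y0 = 0.
    rewrite chart_formE PCE X0 -/f P0 (_ : homogenize e k.+1 0 = 0) ?scaler0 //.
    by rewrite /homogenize big1 // => t _; rewrite coef0 scale0r.
  rewrite eval2_fst -(eval2_shift qf u (- (u i / q 0 i)) rW).
  have -> : eval2 WC qf (fun j => u j + - (u i / q 0 i) * qf j) = 
     q 0 i ^+ N * (chart_form WC i y0).@[fun m => u (lift i m) - u i / q 0 i * q 0 (lift i m)].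
    rewrite chart_form_eval -X0 -(eval2_homog_fst _ _ _ hN).
    congr (eval2 WC _ _); apply/funext => j; rewrite X0 /qf /chart_vec.
    by case: unliftP => [m ->|->] /=; rewrite mulNr // divfK // subrr.
  by rewrite c0 raddf0 mulr0.
have [c [m [n [r [nzc eP r0 nzm sm]]]]] := double_root_square nzP rP rP'.
(* Genericity turns the square factor found at [q] into an identity between polynomials in [x],
   valid near [q] as well. *)
have gen x : f x = 0 -> rho x = 0 by exact: gq.
have ePC : rho c *: PC = map_poly rho n * map_poly rho m ^+ 2.
  rewrite -map_polyZ eP rmorphD rmorphM rmorphXn /= [X in _ + X](_ : _ = 0) ?addr0 //.
  apply/polyP=> t; rewrite coef_map coef0; apply: gen.
  by rewrite -coef_map r0 coef0.
have nzrho x : f x != 0 -> rho x != 0.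
  by apply: contra_neq => x0; rewrite fE x0 raddf0.
have nzrc := nzrho _ nzc.
have smC : size (map_poly rho m) = size m by apply: size_map_poly_id0; exact: nzrho.
have nzPC : PC != 0.
  by apply: contraNneq nzP => PC0; rewrite -(PCE qf) PC0 raddf0.
pose d := (size m).-1.
have [sn n_gt0] : (size (map_poly rho n) + 2 * d <= k.+2)%N /\
    (0 < size (map_poly rho n))%N.
  have [se n_gt0] := size_square_factor nzrc nzPC ePC.
  by rewrite /d -smC se sPC n_gt0.
pose b y := homogenize e d (map_poly (meval (X y)) (map_poly rho m)).
(* The subtraction is not truncated: [n] has nonzero image, so that [2 * d] is at most [k.+1]. The
   division by the value of [c] makes sense near [y0]. *)
pose c' y := homogenize e (k.+1 - 2 * d)
  (((q 0 i)^-1 ^+ N / (rho c).@[X y]) *: map_poly (meval (X y)) (map_poly rho n)).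
have dX j y : differentiable (fun z => X z j) y.
  apply: holo_mul; first exact: differentiable_cst.
  rewrite /chart; under eq_fun do rewrite mxE.
  case: unliftP => [l _|_] /=; last exact: differentiable_cst.
  exact: differentiable_coord.
have dG (G : {mpoly C[3]}) y : differentiable (fun z => G.@[X z]) y.
  by apply: holo_meval => j; exact: dX.
have nzcy0 : (rho c).@[X y0] != 0 by rewrite X0 -fE.
have near_c : \forall y \near y0, (rho c).@[X y] != 0.
  have cont : (fun y => (rho c).@[X y]) @ y0 --> (rho c).@[X y0].
    exact: differentiable_continuous (dG (rho c) y0).
  have FF : Filter (nbhs y0) by exact: nbhs_filter.
  exact: (@cvgr_neq0 _ _ _ (nbhs y0) FF _ _ cont nzcy0).
have holo_map (G : {poly {mpoly C[3]}}) t y :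
    differentiable (fun z => (map_poly (meval (X z)) G)`_t) y.
  by under eq_fun do rewrite coef_map /=; exact: dG.
have [] := sqf b c'.
- by apply: poly_germ_homogenize => t; near=> y; exact: holo_map.
- apply: poly_germ_homogenize => t.
  apply: (@filterS _ (nbhs y0) (nbhs_filter y0) _ _ _ near_c) => y nzcy.
  under eq_fun do rewrite coefZ.
  apply: holo_mul => //; apply: holo_mul; first exact: differentiable_cst.
  exact: (@differentiableV C 'rV[C]_2 _ _ (dG _ y) nzcy).
- apply: (@filterS _ (nbhs y0) (nbhs_filter y0) _ _ _ near_c) => y nzcy.
  set my := map_poly (meval (X y)) (map_poly rho m).
  set ny := map_poly (meval (X y)) (map_poly rho n).
  have ePy : (rho c).@[X y] *: map_poly (meval (X y)) PC = ny * (my * my).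
    by rewrite -map_polyZ ePC rmorphM rmorphXn expr2.
  have smy : (size my <= d.+1)%N.
    by apply: leq_trans (size_poly _ _) _; rewrite smC /d; case: (size m).
  have smy2 : (size (my * my)%R <= (d + d).+1)%N.
    exact: size_polyM_bound.
  have sny : (size ny <= (k.+1 - 2 * d).+1)%N.
    apply: leq_trans (size_poly _ _) _; move: sn n_gt0.
    by move: (size (map_poly rho n)) => a; clear; lia.
  rewrite chart_formE expr2 mulrC [b y * b y](_ : _ = homogenize e (d + d) (my * my));
    last by rewrite homogenizeM.
  rewrite -homogenizeM //; last exact: leq_trans (size_scale_leq _ _) sny.
  have -> : (k.+1 - 2 * d + (d + d) = k.+1)%N.
    by move: sn n_gt0; move: (size (map_poly rho n)) => a; clear; lia.
  by rewrite -homogenizeZ -scalerAl -ePy scalerA mulfVK.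
(* The form [b] has positive degree [d], so it vanishes at the origin and cannot be a unit. *)
move=> u _ near_u.
have bu : b y0 * u y0 = 1 by exact: (@nbhs_singleton _ y0 _ near_u).
have := congr1 (meval (fun=> 0)) bu.
rewrite mevalM meval1 /b homogenize_meval0 ?mul0r; last by rewrite /d; case: (size m) sm => [|[]].
by move/eqP; rewrite eq_sym oner_eq0.
Unshelve. all: by end_near.
Qed.
End DoubleLine.

(** * Polars and their centers *)

Section Polars.
Variable R : realType.
Local Notation C := (Cplx R).
Local Notation coords x := (fun i => x 0 i).

Definition row_of (v : 'I_3 -> C) : 'rV[C]_3 := \row_i v i.

Lemma row_ofK v : coords (row_of v) = v.
Proof. by apply/funext => i; rewrite mxE. Qed.

Lemma eval2_eq0 n (W : {mpoly {mpoly C[n]}[n]}) :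
  (forall x v, eval2 W x v = 0) -> W = 0.
Proof.
move=> W0; apply/mpolyP => m; rewrite mcoeff0; apply: mpoly_eq0_meval => x.
have e0 : map_mpoly (meval x) W = 0.
  by apply: mpoly_eq0_meval => v; rewrite eval2_fst.
by have := congr1 (mcoeff m) e0; rewrite mcoeff_map_mpoly mcoeff0.
Qed.

Lemma eval2_polar (W : {mpoly {mpoly C[3]}[3]}) (v : 'rV[C]_3) x :
  (eval_snd W v).@[x] = eval2 W x (coords v).
Proof. exact: eval2_snd. Qed.

Lemma eval_sndE (W : {mpoly {mpoly C[3]}[3]}) (v : 'rV[C]_3) :
  eval_snd W v = \sum_(m <- msupp W) (\prod_i v 0 i ^+ m i) *: W@_m.
Proof.
rewrite /eval_snd mevalE; apply: eq_bigr => m _; rewrite mulrC -mul_mpolyC.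
by congr (_ * _); rewrite rmorph_prod; apply: eq_bigr => i _; rewrite rmorphXn.
Qed.

Lemma eval_snd_homog (W : {mpoly {mpoly C[3]}[3]}) (v : 'rV[C]_3) N :
  (forall u, W@_u \is N.-homog) -> eval_snd W v \is N.-homog.
Proof. by move=> hW; rewrite eval_sndE; apply: rpred_sum => m _; apply: rpredZ. Qed.

(** These polynomials in the center give the coefficients of the polar curve, hence parametrize the
    polar family. *)
Definition snd_coef (B : comNzRingType) u (W : {mpoly {mpoly B[3]}[3]}) : {mpoly B[3]} :=
  map_mpoly (mcoeff u) W.

Lemma eval_snd_coef (W : {mpoly {mpoly C[3]}[3]}) (v : 'rV[C]_3) u :
  (eval_snd W v)@_u = (snd_coef u W).@[(coords v)].
Proof.
rewrite eval_sndE /snd_coef /map_mpoly /mmap !raddf_sum; apply: eq_bigr => m _ /=.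
rewrite mcoeffZ mevalM mevalC mmap1_id mevalX; exact: mulrC.
Qed.

Lemma mcoeff_snd_coef (B : comNzRingType) u (W : {mpoly {mpoly B[3]}[3]}) m :
  (snd_coef u W)@_m = W@_m@_u.
Proof. exact: mcoeff_map_mpoly. Qed.

Lemma eval2_mderiv_coef (W : {mpoly {mpoly C[3]}[3]}) (v : 'rV[C]_3) l x :
  eval2 (mderiv_coef l W) x (coords v) = (mderiv l (eval_snd W v)).@[x].
Proof.
rewrite -eval2_polar; congr (_.@[x]); apply/mpolyP => u.
rewrite mcoeff_mderiv !eval_snd_coef -raddfMn; congr (_.@[_]).
apply/mpolyP => m; rewrite mcoeff_snd_coef mcoeffMn mcoeff_snd_coef -mcoeff_mderiv.
by congr (_@__); exact: mcoeff_map_mpoly.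
Qed.

Lemma snd_coef_homog (W : {mpoly {mpoly C[3]}[3]}) k u :
  W \is k.-homog -> snd_coef u W \is k.-homog.
Proof.
move=> /dhomogP hW; apply/dhomogP => m; rewrite mcoeff_msupp mcoeff_map_mpoly /= => nz.
apply: hW; rewrite mcoeff_msupp; apply: contraNneq nz => ->.
by rewrite mcoeff0.
Qed.

Lemma snd_coef_map (A : comNzRingType) (ka : {rmorphism A -> C})
    (W : {mpoly {mpoly A[3]}[3]}) u :
  map_mpoly ka (snd_coef u W) = snd_coef u (map_mpoly (map_mpoly ka) W).
Proof.
apply/mpolyP => m; transitivity (ka (snd_coef u W)@_m); first exact: mcoeff_map_mpoly.
rewrite mcoeff_snd_coef; apply/esym/(etrans (mcoeff_snd_coef _ _ _)).
transitivity ((map_mpoly ka W@_m)@_u); last exact: mcoeff_map_mpoly.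
by congr (_@__); exact: mcoeff_map_mpoly.
Qed.

(* The linear map l |-> (l . u) p - (l . p) u is alternating, so that its value
   at [l] is a point of the line [l]; it is [p] if l . u = 1 and l . p = 0. *)
Definition line_pt (B : comNzRingType) (l u p : 'I_3 -> B) (j : 'I_3) : B :=
  (\sum_i l i * u i) * p j - (\sum_i l i * p i) * u j.

(** The function [W(x, line_pt l u p)] of [(x, l)] as a bihomogeneous polynomial: an equation that
    can be tested on the surface of the web. *)
Definition incidence_form (W : {mpoly {mpoly C[3]}[3]}) (u p : 'I_3 -> C) :
    {mpoly {mpoly C[3]}[3]} :=
  \sum_(m <- msupp W) W@_m *: map_mpoly (@mpolyC 3 C)
    (mmap1 (line_pt (fun i => 'X_i) (fun i => (u i)%:MP) (fun i => (p i)%:MP)) m).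

Lemma incidence_form_eval W u p x l :
  (map_mpoly (meval x) (incidence_form W u p)).@[l] = eval2 W x (line_pt l u p).
Proof.
rewrite eval2_fst /incidence_form /eval2 raddf_sum; apply: eq_bigr => m _ /=.
rewrite mmapZ; congr (_ * _).
have mapE (Q : {mpoly C[3]}) : mmap (meval x) l (map_mpoly (@mpolyC 3 C) Q) = Q.@[l].
  move: Q; apply: (mpoly_rmorph_ext
    (F := mmap (meval x) l \o map_mpoly (@mpolyC 3 C)) (G := meval l)) => [c|i] /=.
    by rewrite map_mpolyC mmapC /= !mevalC.
  by rewrite map_mpolyX mmapX mmap1U mevalXU.
rewrite mapE /mmap1 rmorph_prod; apply: eq_bigr => i _.
have dotE (w : 'I_3 -> C) :
    (\sum_j 'X_j * (w j)%:MP : {mpoly C[3]}).@[l] = \sum_j l j * w j.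
  by rewrite raddf_sum; apply: eq_bigr => j _; rewrite /= mevalM mevalXU mevalC.
by rewrite rmorphXn /= /line_pt mevalB !mevalM !mevalC !dotE.
Qed.

Lemma incidence_form_bihomog W u p k N : W \is k.-homog -> (forall m, W@_m \is N.-homog) ->
  bihomog N k (incidence_form W u p).
Proof.
move=> /dhomogP hW hN; split.
  rewrite /incidence_form big_seq; apply: rpred_sum => m /hW <-.
  apply: rpredZ; apply/dhomogP => m'; rewrite mcoeff_msupp mcoeff_map_mpoly /=.
  have : (mmap1 (line_pt (fun i => 'X_i) (fun i => (u i)%:MP)
     (fun i => (p i)%:MP)) m : {mpoly C[3]}) \is (mdeg m).-homog.
    rewrite mdegE /mmap1; elim/big_ind2: _ => [|P a Q b|i _]; first exact: dhomog1.
      exact: dhomogM.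
    suff /(dhomogMn (m i)) : (line_pt (fun i => 'X_i) (fun i => (u i)%:MP)
      (fun i => (p i)%:MP) i : {mpoly C[3]}) \is 1.-homog by rewrite mul1n.
    rewrite /line_pt.
    by apply: rpredB; rewrite mulrC mul_mpolyC; apply: rpredZ; apply: rpred_sum => i' _;
      rewrite mulrC mul_mpolyC; apply: rpredZ; rewrite dhomogX /= mdeg1.
  move=> /dhomogP h nz; apply: h; rewrite mcoeff_msupp.
  by apply: contraNneq nz => ->; rewrite raddf0.
move=> m; rewrite /incidence_form raddf_sum; apply: rpred_sum => m' _ /=.
rewrite mcoeffZ mcoeff_map_mpoly /= mulrC mul_mpolyC.
by apply: rpredZ; exact: hN.
Qed.

End Polars.

Section Webs.
Variable R : realType.
Local Notation C := (Cplx R).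
Local Notation coords x := (fun i => x 0 i).

(** Shifted along [x] into the chart, [v] lies in the kernel of the linear factor defining [l], and
    this factor divides [W(x, .)]. *)
Lemma tangent_line_eval2 k N (W : {mpoly {mpoly C[3]}[3]}) (x l : 'rV[C]_3) (v : 'I_3 -> C) :
  (forall u, W@_u \is N.-homog) -> radial_free W -> tangent_line k W x l ->
  \sum_i l 0 i * v i = 0 -> eval2 W (coords x) v = 0.
Proof.
move=> hN rW [_ [i [a [j [nzxi [_ fac] tl]]]]] lv.
pose y0 := chart_coord i x.
have chE m : chart i y0 0 m = (x 0 i)^-1 * x 0 m.
  rewrite mxE; case: unliftP => [n ->|->] /=; first by rewrite mxE mulrC.
  by rewrite mulVf.
have lx : \sum_m l 0 m * x 0 m = 0.
  have /tl : \sum_(m < 2) a j y0 0 m * (y0 0 m - y0 0 m) = 0.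
    by rewrite big1 // => m _; rewrite subrr mulr0.
  rewrite /incident; under eq_bigr => m _ do rewrite chE mulrCA.
  by rewrite -mulr_sumr => /eqP; rewrite mulf_eq0 invr_eq0 (negbTE nzxi) => /eqP.
pose v' m := v m + - (v i / x 0 i) * x 0 m.
have v'i : v' i = 0 by rewrite /v' mulNr divfK // subrr.
have lv' : \sum_m l 0 m * v' m = 0.
  under eq_bigr => m _ do rewrite mulrDr mulrCA.
  by rewrite big_split /= lv -mulr_sumr lx mulr0 addr0.
have v'E : chart_vec i (fun m => v' (lift i m)) = v'.
  by apply/funext => m; rewrite /chart_vec; case: unliftP => [n ->|->].
have av' : \sum_(m < 2) a j y0 0 m * v' (lift i m) = 0.
  pose y : 'rV[C]_2 := \row_m (y0 0 m + v' (lift i m)).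
  have /tl : incident (chart i y) l.
    rewrite /incident.
    transitivity ((x 0 i)^-1 * (\sum_m l 0 m * x 0 m) + \sum_m l 0 m * v' m); last first.
      by rewrite lx lv' mulr0 addr0.
    rewrite mulr_sumr -big_split /=; apply: eq_bigr => m _.
    rewrite mulrCA -mulrDr -chE !mxE; congr (_ * _).
    case: unliftP => [n ->|->] /=; last by rewrite v'i addr0.
    by rewrite !mxE.
  by under eq_bigr => m _ do rewrite mxE addrAC subrr add0r.
have W0 : chart_form W i y0 = \prod_(j < k) linear_form (a j y0).
  exact: (@nbhs_singleton _ y0 _ fac).
have := congr1 (meval (fun m => v' (lift i m))) W0.
rewrite chart_form_eval v'E (rmorph_prod (meval _)) /= (bigD1 j) //=.
have -> : (linear_form (a j y0)).@[fun m => v' (lift i m)] = 0.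
  by rewrite -av' raddf_sum; apply: eq_bigr => m _; rewrite /= mevalZ mevalXU.
have -> : coords (chart i y0) = (fun m => (x 0 i)^-1 * x 0 m) by apply/funext.
rewrite (eval2_homog_fst _ _ _ hN) mul0r => /eqP.
rewrite mulf_eq0 expf_eq0 invr_eq0 (negbTE nzxi) andbF => /eqP.
by rewrite /v' eval2_shift.
Qed.

(** At a radial center [p], each [x] has a line [l] of the surface passing through [p]. The
    incidence form vanishes on tangent lines, hence at [(x, l)], where a suitable [u] makes its
    value [W(x, p)]; so the polar would be zero. *)
Lemma polar_nonradial k d (W : web R k d) (p : 'rV[C]_3) : (0 < k)%N ->
  polar W p != 0 -> p != 0 /\ ~ radial_center W p.
Proof.
move=> k_gt0 nzP; have [[hk hN] rW] := web_sym W.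
set w := web_form W in hk hN rW *.
have [x nzx] : exists x, eval2 w x (coords p) != 0.
  apply: contrapT => /forallNP no; case/eqP: nzP; apply: mpoly_eq0_meval => x.
  by rewrite eval2_polar; apply/eqP; apply: contrapT => /negP; exact: no.
split.
  apply: contraNneq nzx => ->.
  have -> : coords (0 : 'rV[C]_3) = (fun i => 0 * x i).
    by apply/funext => i; rewrite mxE mul0r.
  by rewrite (eval2_homog_snd _ _ _ hk) expr0n gtn_eqF // mul0r.
move=> rc; have nz_x : row_of x != 0.
  apply: contraNneq nzx => x0.
  have -> : x = (fun i => 0 * x i).
    apply/funext => i; rewrite mul0r; have := congr1 (fun z : 'rV[C]_3 => z 0 i) x0.
    by rewrite !mxE.
  rewrite (eval2_homog_fst _ _ _ hN) expr0n gtn_eqF ?mul0r //.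
  by rewrite addn_gt0 k_gt0 orbT.
have [l [_ nzl surf] pl] := rc _ nz_x.
have /existsNP[j /eqP nzlj] : ~ forall j, l 0 j = 0.
  by move=> l0; case/eqP: nzl; apply/rowP => j; rewrite mxE.
pose u (i : 'I_3) : C := (i == j)%:R / l 0 j.
have lu : \sum_i l 0 i * u i = 1.
  rewrite (bigD1 j) //= big1 => [|i /negbTE ij]; last by rewrite /u ij mul0r mulr0.
  by rewrite /u eqxx mul1r mulfV // addr0.
have := surf _ _ _ (incidence_form_bihomog u (coords p) hk hN).
rewrite /eval_fst incidence_form_eval row_ofK.
have -> : line_pt (coords l) u (coords p) = coords p.
  by apply/funext => i; rewrite /line_pt lu pl mul0r subr0 mul1r.
move=> surf'; case/eqP: nzx; apply: surf' => x' l' _ tl.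
rewrite incidence_form_eval; apply: (tangent_line_eval2 hN rW tl).
rewrite /line_pt; under eq_bigr => i _ do rewrite mulrBr mulrCA [X in _ - X]mulrCA.
by rewrite sumrB -!mulr_sumr mulrC subrr.
Qed.

Lemma polar_relation k d (W1 W2 : web R k d) (q : 'rV[C]_3) : (0 < k)%N ->
  polar_family W1 = polar_family W2 -> polar W2 q != 0 ->
  forall e (Q : {mpoly C[_]}), Q \is e.-homog ->
    (forall v, Q.@[curve_coord (r := d + k) (polar W1 v)] = 0) ->
    Q.@[curve_coord (r := d + k) (polar W2 q)] = 0.
Proof.
move=> k_gt0 hR nzP e Q hQ Q1.
have [nzq nrq] := polar_nonradial k_gt0 nzP.
have hP : polar W2 q \is (d + k).-homog.
  by apply: eval_snd_homog; have [[]] := web_sym W2.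
have F2 : polar_family W2 (polar W2 q).
  apply: conj; first exact: conj nzP hP.
  move=> e' Q' _ H; apply: (H (polar W2 q)).
  exists q; exact: And3 nzq nrq erefl.
have [_ F1] : polar_family W1 (polar W2 q) by rewrite hR.
apply: (F1 e Q hQ) => G [p [_ _ ->]]; exact: Q1.
Qed.

Lemma web_form_neq0 k d (W : web R k d) : web_form W != 0.
Proof.
have [e [D [[nzD _] smD]]] := web_generic W.
(* The extra factor ensures that the point found is a nonzero vector, as homogeneous coordinates
   must be. *)
have /existsNP[x /eqP nzDx] : ~ forall x, ('X_ord0 * D).@[x] = 0.
  move=> D0; have /eqP := mpoly_eq0_meval D0.
  by rewrite mulf_eq0 (negbTE nzD) orbF -msize_poly_eq0 msizeX.
move: nzDx; rewrite mevalM mevalXU mulf_eq0 negb_or => /andP[nzx nzDx].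
have [|| _ nsing _] := smD (row_of x).
- by apply: contraNneq nzx => /rowP/(_ ord0); rewrite !mxE => ->.
- by rewrite (row_ofK x).
by apply/eqP => W0; apply: nsing; rewrite W0 /singular /eval_fst raddf0.
Qed.

End Webs.

Section Recovery.
Variable R : realType.
Local Notation C := (Cplx R).
Local Notation coords x := (fun i => x 0 i).

Lemma coef_lift n (A : comNzRingType) (ka : {rmorphism A -> C}) (s : seq C) (P : {mpoly C[n]}) :
  (forall c, c \in s -> exists a, ka a = c) ->
  {subset [seq P@_m | m <- msupp P] <= s} -> exists Q, map_mpoly ka Q = P.
Proof.
move=> hs Ps; apply: lift_mpoly => m mP; apply/hs/Ps.
by apply/mapP; exists m.
Qed.

Lemma coef_lift2 n (A : comNzRingType) (ka : {rmorphism A -> C}) (s : seq C)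
    (W : {mpoly {mpoly C[n]}[n]}) :
  (forall c, c \in s -> exists a, ka a = c) ->
  {subset [seq W@_m@_u | m <- msupp W, u <- msupp W@_m] <= s} ->
  exists V, map_mpoly (map_mpoly ka) V = W.
Proof.
move=> hs Ws; apply: lift_mpoly => m mW; apply: (coef_lift hs) => c /mapP[u uW ->].
by apply: Ws; apply/allpairsPdep; exists m, u.
Qed.

Lemma generic_polar_neq0 (A : comNzRingType) (ka : {rmorphism A -> C})
    (W : {mpoly {mpoly A[3]}[3]}) (q : 'rV[C]_3) :
  generic_point ka (coords q) -> map_mpoly (map_mpoly ka) W != 0 ->
  eval_snd (map_mpoly (map_mpoly ka) W) q != 0.
Proof.
move=> gq; apply: contra_neq => W0; apply/mpolyP => m; rewrite mcoeff0.
apply/mpolyP => u; rewrite mcoeff0 -mcoeff_snd_coef -snd_coef_map.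
rewrite (gq (snd_coef u W)) ?mcoeff0 // -meval_map_mpoly snd_coef_map -eval_snd_coef.
by rewrite W0 mcoeff0.
Qed.

Lemma mpoly_ext n (P Q : {mpoly C[n]}) : (forall x, P.@[x] = Q.@[x]) -> P = Q.
Proof.
move=> PQ; apply/eqP; rewrite -subr_eq0; apply/eqP/mpoly_eq0_meval => x.
by rewrite mevalB PQ subrr.
Qed.

Lemma proportional_coefs n (F G : {mpoly C[n]}) :
  (forall u u', F@_u * G@_u' = F@_u' * G@_u) ->
  forall x y, F.@[x] * G.@[y] = F.@[y] * G.@[x].
Proof.
move=> FG x y.
have [->|/eqP nzF] := eqVneq F 0; first by rewrite !raddf0 !mul0r.
have /existsNP[u /eqP nzFu] : ~ forall u, F@_u = 0.
  by move=> F0; apply: nzF; apply/mpolyP => u; rewrite F0 mcoeff0.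
have -> : G = (G@_u / F@_u) *: F.
  apply/mpolyP => u'; rewrite mcoeffZ; apply: (mulfI nzFu); rewrite FG.
  by field.
by rewrite !mevalZ; ring.
Qed.

Lemma eval_snd_row (W : {mpoly {mpoly C[3]}[3]}) v x :
  (eval_snd W (row_of v)).@[x] = eval2 W x v.
Proof. by apply: etrans (eval2_polar _ _ _) _; rewrite row_ofK. Qed.

Lemma mcoeff_eval_snd_row (W : {mpoly {mpoly C[3]}[3]}) v u :
  (eval_snd W (row_of v))@_u = (snd_coef u W).@[v].
Proof. by apply: etrans (eval_snd_coef _ _ _) _; rewrite row_ofK. Qed.

Lemma eval_snd_scale k (W : {mpoly {mpoly C[3]}[3]}) (p q : 'rV[C]_3) t :
  W \is k.-homog -> (forall i, p 0 i = t * q 0 i) ->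
  eval_snd W p = t ^+ k *: eval_snd W q.
Proof.
move=> hW pt; apply: mpoly_ext => x; apply: etrans (esym (mevalZ _ _ _)).
apply: etrans (eval2_polar W p x) _.
transitivity (t ^+ k * eval2 W x (coords q)).
  apply: etrans (eval2_homog_snd _ _ _ hW).
  by congr (eval2 W x _); apply/funext.
by congr (_ * _); apply/esym/eval2_polar.
Qed.

(* A polar [w2(x, q)] is singular at its center [q], since the web has at least
   two lines through it. *)
Lemma generic_center k N (A : comNzRingType) (ka : {rmorphism A -> C})
    (V1 V2 : {mpoly {mpoly A[3]}[3]}) (q p : 'rV[C]_3)
    (w1 := map_mpoly (map_mpoly ka) V1) (w2 := map_mpoly (map_mpoly ka) V2) :
  generic_point ka (coords q) -> generic_point ka (coords p) ->
  w1 \is k.+2.-homog -> (forall u, w1@_u \is N.-homog) -> radial_free w1 ->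
  w2 \is k.+2.-homog -> radial_free w2 -> smooth_point k.+2 w1 q ->
  eval_snd w1 p = eval_snd w2 q ->
  exists c, forall u, (eval_snd w2 q)@_u = c * (eval_snd w1 q)@_u.
Proof.
move=> gq gp h1 N1 r1 h2 r2 smq e.
have w1qp : eval2 w1 (coords q) (coords p) = 0.
  by rewrite -eval2_polar e eval2_polar (eval2_diag _ r2 h2).
have dw1 l : eval2 (mderiv_coef l w1) (coords q) (coords p) = 0.
  rewrite eval2_mderiv_coef e -eval2_mderiv_coef.
  exact: (eval2_mderiv_coef_diag (k := k)).
have dw1' := generic_tangency gp w1qp dw1.
have [t pt] := generic_no_double_line gq h1 N1 r1 smq w1qp dw1'.
exists (t ^+ k.+2) => u; apply: etrans (mcoeffZ _ _ _); congr (_@_u).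
apply: etrans (esym e) _; exact: eval_snd_scale h1 pt.
Qed.

(** For each [v] the forms [w1(., v)] and [w2(., v)] are proportional. The ratios at [v] and [q0]
    are compared at the point [x = v - q0], where shift invariance gives [w(x, v) = w(x, q0)] for
    both forms. *)
Lemma proportional_forms (w1 w2 : {mpoly {mpoly C[3]}[3]}) :
  radial_free w1 -> radial_free w2 -> w1 != 0 -> w2 != 0 ->
  (forall v u u', (snd_coef u w2).@[v] * (snd_coef u' w1).@[v] =
                  (snd_coef u' w2).@[v] * (snd_coef u w1).@[v]) ->
  exists2 c : C, c != 0 & w1 = c%:MP *: w2.
Proof.
move=> r1 r2 nz1 nz2 prop.
have prop2 x y v : eval2 w2 x v * eval2 w1 y v = eval2 w2 y v * eval2 w1 x v.
  have FG u u' : (eval_snd w2 (row_of v))@_u * (eval_snd w1 (row_of v))@_u' =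
      (eval_snd w2 (row_of v))@_u' * (eval_snd w1 (row_of v))@_u.
    transitivity ((snd_coef u w2).@[v] * (snd_coef u' w1).@[v]).
      by congr (_ * _); exact: mcoeff_eval_snd_row.
    apply: etrans (prop v u u') _.
    by congr (_ * _); apply/esym/mcoeff_eval_snd_row.
  transitivity ((eval_snd w2 (row_of v)).@[x] * (eval_snd w1 (row_of v)).@[y]).
    by congr (_ * _); apply/esym/eval_snd_row.
  apply: etrans (proportional_coefs FG x y) _.
  by congr (_ * _); exact: eval_snd_row.
have [x0 [q0 nz0]] : exists x0 q0, eval2 w2 x0 q0 != 0.
  apply: contrapT => no; case/eqP: nz2; apply: eval2_eq0 => x v.
  by apply/eqP; apply: contrapT => /negP nz; apply: no; exists x, v.
pose c := eval2 w1 x0 q0 / eval2 w2 x0 q0.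
have w1q0 x : eval2 w1 x q0 = c * eval2 w2 x q0.
  have := prop2 x0 x q0; rewrite /c; move: nz0.
  move: (eval2 w1 x0 q0) (eval2 w2 x0 q0) (eval2 w1 x q0) (eval2 w2 x q0) => a b a' b' nzb e.
  by apply: (mulfI nzb); rewrite e; field.
(* The comparison works where [w2(v - q0, q0)] is nonzero; this is a nonzero polynomial in [v] and
   can be cancelled. *)
pose H := eval_snd w2 (row_of q0) \mPo [tuple 'X_i - (q0 i)%:MP | i < 3].
have HE v : H.@[v] = eval2 w2 (fun i => v i - q0 i) q0.
  rewrite /H comp_mpoly_meval; apply: etrans (eval_snd_row _ _ _) _; congr (eval2 w2 _ _).
  by apply/funext => i; rewrite tnth_mktuple mevalB mevalXU mevalC.
have nzH : H != 0.
  apply: contraNneq nz0 => H0; have := HE (fun i => q0 i + x0 i).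
  rewrite H0 raddf0 (_ : (fun i => _) = x0) => [<- //|].
  by apply/funext => i; rewrite addrC addKr.
have w1E : w1 = c%:MP *: w2.
  apply/eqP; rewrite -subr_eq0; apply/eqP; apply: eval2_eq0 => y v.
  pose K := map_mpoly (meval y) w1 - c *: map_mpoly (meval y) w2.
  suff K0 : K = 0.
    apply: etrans (esym (eval2_fst _ _ _)) _.
    suff -> : map_mpoly (meval y) (w1 - c%:MP *: w2) = K by rewrite K0 raddf0.
    by rewrite raddfB /= map_mpolyZ /K; congr (_ - _ *: _); exact: mevalC.
  apply: (mulfI nzH); rewrite mulr0; apply: mpoly_eq0_meval => v'.
  have KE : K.@[v'] = eval2 w1 y v' - c * eval2 w2 y v'.
    apply: etrans (mevalB _ _ _) _; congr (_ - _); first exact: eval2_fst.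
    by apply: etrans (mevalZ _ _ _) _; congr (_ * _); exact: eval2_fst.
  apply: etrans (mevalM _ _ _) _; rewrite KE HE.
  set x := fun i => v' i - q0 i.
  have sh w : radial_free w -> eval2 w x v' = eval2 w x q0.
    move=> rw; apply: etrans (eval2_shift x q0 1 rw); congr (eval2 w x _).
    by apply/funext => i; rewrite mul1r /x addrC subrK.
  have := prop2 x y v'; rewrite (sh _ r1) (sh _ r2) w1q0.
  move: (eval2 w2 x q0) (eval2 w1 y v') (eval2 w2 y v') => a b b' e.
  by rewrite mulrBr e; ring.
exists c => //; apply: contraNneq nz1 => c0.
by rewrite w1E c0 mpolyC0 scale0r.
Qed.

Lemma polar_family_inj k d (W1 W2 : web R k.+2 d) :
  polar_family W1 = polar_family W2 -> same_web W1 W2.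
Proof.
move=> hR.
have [[h1 N1] r1] := web_sym W1; have [[h2 N2] r2] := web_sym W2.
have [e [D [[nzD _] smD]]] := web_generic W1.
have nz1 := web_form_neq0 W1; have nz2 := web_form_neq0 W2.
pose s1 := [seq (web_form W1)@_m@_u | m <- msupp (web_form W1), u <- msupp (web_form W1)@_m].
pose s2 := [seq (web_form W2)@_m@_u | m <- msupp (web_form W2), u <- msupp (web_form W2)@_m].
(* With the coefficients of the exceptional curve [D] in the ring, a generic point avoids this curve
   and is smooth for the first web. *)
pose s3 := [seq D@_m | m <- msupp D].
have [A [ka [cA hka]]] := countable_coef_ring (s1 ++ s2 ++ s3).
have [V1 E1] : exists V, map_mpoly (map_mpoly ka) V = web_form W1.
  by apply: (coef_lift2 hka) => c cs; rewrite !mem_cat -/s1 cs.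
have [V2 E2] : exists V, map_mpoly (map_mpoly ka) V = web_form W2.
  by apply: (coef_lift2 hka) => c cs; rewrite !mem_cat -/s2 cs orbT.
have [D' ED] : exists Q, map_mpoly ka Q = D.
  by apply: (coef_lift hka) => c cs; rewrite !mem_cat -/s3 cs !orbT.
have [qf gqf] := generic_point_exists 3 ka cA.
pose q := row_of qf; have gq : generic_point ka (fun i => q 0 i) by rewrite row_ofK.
have smq : smooth_point k.+2 (web_form W1) q.
  apply: smD; last first.
    rewrite row_ofK -ED meval_map_mpoly; apply: contra_neq nzD => /gqf.
    by rewrite ED.
  apply/eqP => q0; have := gqf 'X_ord0; rewrite mmapX mmap1U map_mpolyX.
  rewrite -(row_ofK qf) -/q q0 mxE => /(_ erefl)/eqP.
  by rewrite -msize_poly_eq0 msizeX.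
pose u j := bmnm (@enum_val _ {: 'X_{1..3 < (d + k.+2).+1}} j).
have coordE V (W : web R k.+2 d) (v : 'I_3 -> C) : map_mpoly (map_mpoly ka) V = web_form W ->
    curve_coord (r := d + k.+2) (polar W (row_of v))
    = fun j => mmap ka v (snd_coef (u j) V).
  move=> EV; apply/funext => j; rewrite /curve_coord /polar -EV eval_snd_coef.
  by rewrite -snd_coef_map meval_map_mpoly row_ofK.
have relation V V' (W W' : web R k.+2 d) : map_mpoly (map_mpoly ka) V = web_form W ->
    map_mpoly (map_mpoly ka) V' = web_form W' ->
    polar_family W = polar_family W' ->
    forall e (Q : {mpoly C[_]}), Q \is e.-homog ->
    (forall v, Q.@[fun j => mmap ka v (snd_coef (u j) V)] = 0) ->
    Q.@[fun j => mmap ka qf (snd_coef (u j) V')] = 0.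
  move=> EV EV' eW e' Q hQ Q0.
  have nzq : polar W' q != 0.
    rewrite /polar -EV'; apply: (generic_polar_neq0 gq).
    by rewrite EV'; exact: web_form_neq0.
  have QW v : Q.@[curve_coord (r := d + k.+2) (polar W v)] = 0.
    have -> : v = row_of (fun i => v 0 i) by apply/rowP => i; rewrite mxE.
    by rewrite (coordE V W _ EV).
  have := polar_relation (ltn0Sn _) eW nzq hQ QW.
  by rewrite (coordE V' W' qf EV').
have [pf gp ppq] : exists2 p, generic_point ka p &
    forall j, mmap ka p (snd_coef (u j) V1) = mmap ka qf (snd_coef (u j) V2).
  have hom V (W : web R k.+2 d) j : map_mpoly (map_mpoly ka) V = web_form W ->
      web_form W \is k.+2.-homog -> map_mpoly ka (snd_coef (u j) V) \is k.+2.-homog.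
    by move=> EV hW; rewrite snd_coef_map EV; exact: snd_coef_homog.
  exact: (generic_pair cA (ltn0Sn _) gqf (fun j => hom V1 W1 j E1 h1)
    (fun j => hom V2 W2 j E2 h2) (relation V1 V2 W1 W2 E1 E2 hR)
    (relation V2 V1 W2 W1 E2 E1 (esym hR))).
have mcoefE m V (W : web R k.+2 d) (v : 'I_3 -> C) :
    map_mpoly (map_mpoly ka) V = web_form W ->
    (eval_snd (web_form W) (row_of v))@_m = mmap ka v (snd_coef m V).
  move=> EV; apply: etrans (mcoeff_eval_snd_row _ _ _) _.
  by rewrite -EV -snd_coef_map meval_map_mpoly.
have ep : eval_snd (web_form W1) (row_of pf) = eval_snd (web_form W2) q.
  have hF1 := eval_snd_homog (row_of pf) N1; have hF2 := eval_snd_homog q N2.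
  (* The curve coordinates only see monomials of bounded degree; both polars are homogeneous of
     degree [d + k.+2], so nothing else occurs. *)
  apply/mpolyP => m; have [mN|mN] := eqVneq (mdeg m) (d + k.+2)%N; last first.
    exact: etrans (dhomog_nemf_coeff hF1 mN) (esym (dhomog_nemf_coeff hF2 mN)).
  have mlt : (mdeg m < (d + k.+2).+1)%N by rewrite mN.
  have := ppq (enum_rank (BMultinom mlt)); rewrite /u enum_rankK /= => ppqm.
  exact: etrans (mcoefE m V1 W1 pf E1) (etrans ppqm (esym (mcoefE m V2 W2 qf E2))).
have [c cq] : exists c, forall u,
    (eval_snd (web_form W2) q)@_u = c * (eval_snd (web_form W1) q)@_u.
  have := @generic_center k (d + k.+2)%N A ka V1 V2 q (row_of pf).
  rewrite E1 E2 row_ofK => /(_ gq gp h1 N1 r1 h2 r2 smq ep).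
  exact.
apply: (proportional_forms r1 r2 nz1 nz2) => v m m'.
have a1 := mcoefE _ V1 W1 qf E1; have a2 := mcoefE _ V2 W2 qf E2.
have a12 n : mmap ka qf (snd_coef n V2) = c * mmap ka qf (snd_coef n V1).
  by apply: etrans (esym (a2 n)) (etrans (cq n) _); congr (_ * _); exact: a1.
have minorE (f : {rmorphism {mpoly A[3]} -> C}) x y z t :
    f (x * y - z * t) = f x * f y - f z * f t by rewrite rmorphB !rmorphM.
(* Proportionality at the generic center [q], expressed by minors with coefficients in the ring,
   spreads to every center [v]. *)
have minor0 : mmap ka v (snd_coef m V2 * snd_coef m' V1 - snd_coef m' V2 * snd_coef m V1) = 0.
  have q0 : mmap ka qf (snd_coef m V2 * snd_coef m' V1 - snd_coef m' V2 * snd_coef m V1) = 0.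
    have lin (x y s t : C) : x = c * s -> y = c * t -> x * t - y * s = 0.
      by move=> -> ->; rewrite mulrAC subrr.
    exact: etrans (minorE (mmap ka qf) _ _ _ _) (lin _ _ _ _ (a12 m) (a12 m')).
  by apply: etrans (esym (meval_map_mpoly _ _ _)) _; rewrite (gqf _ q0) raddf0.
have coefvE n V (W : web R k.+2 d) : map_mpoly (map_mpoly ka) V = web_form W ->
    (snd_coef n (web_form W)).@[v] = mmap ka v (snd_coef n V).
  by move=> <-; rewrite -snd_coef_map meval_map_mpoly.
transitivity (mmap ka v (snd_coef m V2) * mmap ka v (snd_coef m' V1)).
  by congr (_ * _); exact: coefvE.
transitivity (mmap ka v (snd_coef m' V2) * mmap ka v (snd_coef m V1)).
  by apply/eqP; rewrite -subr_eq0; apply/eqP/(etrans (esym (minorE (mmap ka v) _ _ _ _))).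
by congr (_ * _); apply: esym; exact: coefvE.
Qed.

End Recovery.

Local Close Scope classical_set_scope.
Local Close Scope ring_scope.

Theorem theorem3p2 (R : realType) (k d : nat) (hk : 2 <= k) (W1 W2 : web R k d)
  (hR : polar_family W1 = polar_family W2) : same_web W1 W2.
Proof.
case: k hk W1 W2 hR => [|[|k]] hk W1 W2 hR; [discriminate hk | discriminate hk |].
exact: polar_family_inj hR.
Qed.
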